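(* Let $\alpha>1$ and $f_a(x)=-|x|^{\alpha}+a$. Let $\bar a_1$ be the value such that the set of parameters $\bar a$ for which the kneading sequence of $f_a$ is $RLRL\ldots$ (i.e. $(2k+1)_a>0$ and $(2k+2)_a<0$ for all $k\ge0$) is the half-line $(-\infty,\bar a_1)$. For $\bar a\in(-\infty,\bar a_1)$ and all non-negative integers $n$, the ratio functions $$r^n_e=\frac{|(2n+4)_a-(2n+2)_a|}{|(2n+2)_a-(2n)_a|}\quad\text{and}\quad r^n_o=\frac{|(2n+5)_a-(2n+3)_a|}{|(2n+3)_a-(2n+1)_a|}$$ are strictly increasing in $\bar a$. Moreover, when the parameter increases from $\bar a$ to $\bar a'$ within $(-\infty,\bar a_1)$, then for every $n\in\mathbb{Z}_+$ $$p_{(n+2)_{a'},n_{a'}}\big((n+4)_{a'}\big)-p_{(n+2)_a,n_a}\big((n+4)_a\big)>p_{1,-1}(2_{a'})-p_{1,-1}(2_a).$$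
   Context: Poincaré coordinates: for real $p\neq q$ and $x$ strictly between $p$ and $q$ (the oriented open interval $(p,q)$, where $p>q$ is allowed), $p_{p,q}(x)=\ln\frac{x-p}{q-x}$. Rescaled orbit: for $a>1$ and $n\ge0$, $n_a=f_a^n(0)/f_a(0)$ (so $0_a=0$, $1_a=1$), i.e. the $n$-th iterate of $0$ under $x\mapsto1-a^{\alpha-1}|x|^\alpha$; when $2_a\in(-1,0)$ the parameter is $\bar a=p_{0,1}(|2_a|)=\ln\frac{|2_a|}{1-|2_a|}$, which increases with $a$. The kneading symbol of $n_a$ is $R$ if $n_a>0$, $L$ if $n_a<0$. *)

(* Defs.v *)
From Stdlib Require Import Reals Lra.
Open Scope R_scope.

(* |x|^alpha, with the correct value 0 at x = 0 (Stdlib's Rpower 0 _ is junk). *)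
Definition abspow (alpha x : R) : R :=
  if Req_EM_T x 0 then 0 else Rpower (Rabs x) alpha.

Definition fmap (alpha a x : R) : R := - abspow alpha x + a.

Definition orb (alpha a : R) (n : nat) : R :=
  Nat.iter n (fmap alpha a) 0 / fmap alpha a 0.

Definition poincare (p q x : R) : R := ln ((x - p) / (q - x)).

Definition admissible (alpha a : R) : Prop :=
  1 < a /\ -1 < orb alpha a 2 < 0.

Definition abar (alpha a : R) : R := poincare 0 1 (Rabs (orb alpha a 2)).

Definition kneading_RL (alpha a : R) : Prop :=
  forall k : nat, 0 < orb alpha a (2*k+1) /\ orb alpha a (2*k+2) < 0.

Definition r_e (alpha a : R) (n : nat) : R :=
  Rabs (orb alpha a (2*n+4) - orb alpha a (2*n+2)) /
  Rabs (orb alpha a (2*n+2) - orb alpha a (2*n)).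

Definition r_o (alpha a : R) (n : nat) : R :=
  Rabs (orb alpha a (2*n+5) - orb alpha a (2*n+3)) /
  Rabs (orb alpha a (2*n+3) - orb alpha a (2*n+1)).

(* Main.v *)
Require Import Defs.
From Stdlib Require Import Reals Lra Lia.
From Coquelicot Require Import Coquelicot.
Open Scope R_scope.

(* Put q_n = |n_a|, t = a^(al-1), u_n = |ln q_{n+2} - ln q_n|, P_n the Poincare coordinate of (n+4)_a in ((n+2)_a, n_a) and L_n = ln (e^{u_n} - 1).  Up to an affine map q_{n+1} is q_n^al, so P_{n+1} - P_n depends on u_n and u_{n+2} only: it is a gain H(u_n) + J(u_n, u_{n+2}) if q_n is the smallest of q_n, q_{n+2}, q_{n+4} (n = 0, 3 mod 4) and a loss -f(u_n) + J(u_n, u_{n+2}) otherwise, with H, f, J increasing.  Two parameters are compared, and it is shown by induction that all P_n and L_n grow by more than p_{1,-1}(2) does.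

   A gain at n together with the loss at n+2 is H(u_n - u_{n+2}) + J(u_{n+2}, u_{n+4}).  If u_n - u_{n+2} grows, so does this sum; if it shrinks, then P_n = L_{n+2} - ln (1 - e^{-(u_n - u_{n+2})}) shows that P_n plus the sum grows at least as fast as L_{n+2}, which in turn grows at least as fast as L_n.  In the latter case the loss at n+1 loses its partner when n is even; it is then paid by L_{n+1}, or by the growth of |(n+2)_a - n_a| / |n_a - (n-2)_a|.  The loss at n = 1 has no partner and is absorbed by P_0, which is a one-variable inequality. *)

(** * Exponential inequalities and monotonicity from a derivative *)

(** Bernoulli's inequality with base e^x: multiply 1 + (b-1) x <= e^((b-1) x) by e^x and use e^x - 1
    <= x e^x. *)
Lemma bernoulli_exp (b x : R) : 1 <= b -> 1 + b * (exp x - 1) <= exp (b * x).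
Proof.
intros hb.
assert (h1 : exp (b * x) = exp x * exp ((b - 1) * x)).
{ rewrite <- exp_plus; f_equal; ring. }
assert (h2 : 1 + (b - 1) * x <= exp ((b - 1) * x)) by apply exp_ineq1_le.
assert (h3 : exp x - 1 <= exp x * x).
{ assert (h4 : 1 + - x <= exp (- x)) by apply exp_ineq1_le.
  assert (h5 : exp x * exp (- x) = 1).
  { rewrite <- exp_plus, Rplus_opp_r; apply exp_0. }
  pose proof (exp_pos x); nra. }
pose proof (exp_pos x).
rewrite h1; nra.
Qed.

Lemma exp_gt_1 (u : R) : 0 < u -> 1 < exp u.
Proof. intros; rewrite <- exp_0; apply exp_increasing; lra. Qed.

Lemma exp_gt_1_scaled (al u : R) : 0 < al -> 0 < u -> 1 < exp (al * u).
Proof. intros; apply exp_gt_1, Rmult_lt_0_compat; lra. Qed.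

Lemma nondecreasing_of_derive (F dF : R -> R) (a b : R) :
  a <= b ->
  (forall x, a <= x <= b -> is_derive F x (dF x)) ->
  (forall x, a <= x <= b -> 0 <= dF x) -> F a <= F b.
Proof.
intros hab hd hp.
destruct (MVT_gen F a b dF) as [c [hc he]].
- intros x hx; apply hd; rewrite Rmin_left, Rmax_right in hx; lra.
- intros x hx; apply derivable_continuous_pt; exists (dF x).
  apply is_derive_Reals, hd; rewrite Rmin_left, Rmax_right in hx; lra.
- rewrite Rmin_left, Rmax_right in hc by lra.
  assert (h := hp c hc); nra.
Qed.

(** * The distortion functions of the power map in logarithmic coordinates *)

(** For u = ln (x/y) with 0 < y < x, [lgap u] is ln ((x-y)/y), the gap relative to its lower end.
    [fgap] is the change of this coordinate under x -> x^al, and [- hgap] is the change of ln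
    ((x-y)/x), the gap relative to its upper end. [sgap] equals ln (sinh (al u/2) / sinh (u/2)). *)
Definition lgap (u : R) : R := ln (exp u - 1).
Definition fgap (al u : R) : R := ln ((exp (al * u) - 1) / (exp u - 1)).
Definition hgap (al u : R) : R := (al - 1) * u - fgap al u.
Definition sgap (al u : R) : R := fgap al u - (al - 1) / 2 * u.
Definition jgap (al u w : R) : R := sgap al u + sgap al w - sgap al (u - w).

Definition dfgap (al u : R) : R :=
  al - 1 + al / (exp (al * u) - 1) - 1 / (exp u - 1).

Lemma fgap_derive (al u : R) :
  1 < al -> 0 < u -> is_derive (fgap al) u (dfgap al u).
Proof.
intros ha hu.
assert (h1 := exp_gt_1 u hu).
assert (h2 := exp_gt_1_scaled al u ltac:(lra) hu).
unfold fgap, dfgap; auto_derive.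
- repeat split; try lra. apply Rdiv_lt_0_compat; lra.
- field; lra.
Qed.

Lemma dfgap_le (al u : R) : 1 < al -> 0 < u -> dfgap al u <= al - 1.
Proof.
intros ha hu.
assert (h1 := exp_gt_1 u hu).
assert (h2 := bernoulli_exp al u ltac:(lra)).
unfold dfgap.
assert (al / (exp (al * u) - 1) <= 1 / (exp u - 1)); [|lra].
apply Rmult_le_reg_r with (exp (al * u) - 1); [nra|].
apply Rmult_le_reg_r with (exp u - 1); [lra|].
field_simplify; try lra; nra.
Qed.

(** With denominators cleared this is (al-1) sinh ((al+1)u/2) >= (al+1) sinh ((al-1)u/2), that is
    [T u] >= 0. Here T(0) = 0, and the last factor of T' is nonnegative by Bernoulli at -x. The
    bound makes [sgap] nondecreasing. *)
Lemma dfgap_ge (al u : R) : 1 < al -> 0 < u -> (al - 1) / 2 <= dfgap al u.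
Proof.
intros ha hu.
assert (h1 := exp_gt_1 u hu).
assert (h2 := exp_gt_1_scaled al u ltac:(lra) hu).
pose (T := fun x => (al - 1) * (exp ((al + 1) * x) - 1)
                    - (al + 1) * (exp (al * x) - exp x)).
assert (hT : T 0 <= T u).
{ apply nondecreasing_of_derive with
    (fun x => (al + 1) * (exp ((al + 1) * x))
              * (al - 1 + exp (- (al * x)) - al * exp (- x))); [lra| |].
  - intros x _; unfold T; auto_derive; [easy|].
    replace ((al + 1) * x) with (al * x + x) by ring.
    rewrite exp_plus, !exp_Ropp.
    pose proof (exp_pos x); pose proof (exp_pos (al * x)).
    field; lra.
  - intros x _.
    pose proof (exp_pos ((al + 1) * x)).
    assert (hb := bernoulli_exp al (- x) ltac:(lra)).
    replace (al * - x) with (- (al * x)) in hb by ring.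
    apply Rmult_le_pos; [|lra]. apply Rmult_le_pos; lra. }
unfold T in hT.
rewrite !Rmult_0_r, exp_0 in hT.
replace ((al + 1) * u) with (al * u + u) in hT by ring.
rewrite exp_plus in hT.
unfold dfgap.
assert (h3 : dfgap al u - (al - 1) / 2 =
  ((al - 1) * (exp (al * u) * exp u - 1) - (al + 1) * (exp (al * u) - exp u))
  / (2 * (exp (al * u) - 1) * (exp u - 1))).
{ unfold dfgap; field; lra. }
unfold dfgap in h3.
assert (0 <= ((al - 1) * (exp (al * u) * exp u - 1) - (al + 1) * (exp (al * u) - exp u))
  / (2 * (exp (al * u) - 1) * (exp u - 1))); [|lra].
apply Rdiv_le_0_compat; [lra|].
apply Rmult_lt_0_compat; nra.
Qed.

(** This is al sinh (u/2) <= sinh (al u/2), multiplied by 2 e^(al u/2). *)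
Lemma exp_sinh_bound (al u : R) : 1 < al -> 0 < u ->
  al * (exp ((al - 1) / 2 * u) * (exp u - 1)) <= exp (al * u) - 1.
Proof.
intros ha hu.
pose (T := fun x => exp (al * x) - 1 - al * (exp ((al - 1) / 2 * x) * (exp x - 1))).
assert (hT : T 0 <= T u).
{ apply nondecreasing_of_derive with
    (fun x => al * exp ((al - 1) / 2 * x)
              * (exp ((al + 1) / 2 * x) - (1 + (al + 1) / 2 * (exp x - 1)))); [lra| |].
  - intros x _; unfold T; auto_derive; [easy|].
    replace (al * x) with ((al - 1) / 2 * x + (al + 1) / 2 * x) by field.
    rewrite exp_plus. field.
  - intros x _.
    pose proof (exp_pos ((al - 1) / 2 * x)).
    assert (hb := bernoulli_exp ((al + 1) / 2) x ltac:(lra)).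
    apply Rmult_le_pos; [|lra]. apply Rmult_le_pos; lra. }
unfold T in hT. rewrite !Rmult_0_r, exp_0 in hT. lra.
Qed.

(** Convexity of [fgap]: its second derivative is a quarter of 1/sinh^2 (x/2) - al^2/sinh^2 (al
    x/2), nonnegative by [exp_sinh_bound]. *)
Lemma dfgap_mono (al u w : R) : 1 < al -> 0 < u <= w -> dfgap al u <= dfgap al w.
Proof.
intros ha [hu huw].
apply nondecreasing_of_derive with
  (fun x => exp x / (exp x - 1) ^ 2 - al ^ 2 * exp (al * x) / (exp (al * x) - 1) ^ 2);
  [lra| |].
- intros x hx.
  assert (h1 := exp_gt_1 x ltac:(lra)).
  assert (h2 := exp_gt_1_scaled al x ltac:(lra) ltac:(lra)).
  unfold dfgap; auto_derive; [repeat split; lra|].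
  field; lra.
- intros x hx.
  assert (h1 := exp_gt_1 x ltac:(lra)).
  assert (h2 := exp_gt_1_scaled al x ltac:(lra) ltac:(lra)).
  assert (h3 := exp_sinh_bound al x ha ltac:(lra)).
  set (k := exp ((al - 1) / 2 * x)) in h3.
  assert (hk : exp (al * x) = exp x * k ^ 2).
  { unfold k; simpl; rewrite Rmult_1_r, <- !exp_plus; f_equal; field. }
  assert (hk0 : 0 < k) by apply exp_pos.
  assert (h4 : (al * (k * (exp x - 1))) ^ 2 <= (exp (al * x) - 1) ^ 2).
  { apply pow_incr; split; [|lra].
    apply Rmult_le_pos; [lra|]. apply Rmult_le_pos; lra. }
  assert (h5 : exp x / (exp x - 1) ^ 2 - al ^ 2 * exp (al * x) / (exp (al * x) - 1) ^ 2
    = exp x * ((exp (al * x) - 1) ^ 2 - (al * (k * (exp x - 1))) ^ 2)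
      / ((exp x - 1) ^ 2 * (exp (al * x) - 1) ^ 2)).
  { replace (al ^ 2 * exp (al * x)) with (al ^ 2 * (exp x * k ^ 2)) by (rewrite hk; ring).
    field; lra. }
  rewrite h5.
  apply Rdiv_le_0_compat.
  + apply Rmult_le_pos; [left; apply exp_pos|lra].
  + apply Rmult_lt_0_compat; apply pow_lt; lra.
Qed.

Lemma sgap_le (al u w : R) : 1 < al -> 0 < u <= w -> sgap al u <= sgap al w.
Proof.
intros ha [hu huw].
apply nondecreasing_of_derive with (fun x => dfgap al x - (al - 1) / 2); [lra| |].
- intros x hx. unfold sgap.
  apply (is_derive_minus (fgap al) (fun x => (al - 1) / 2 * x)).
  + apply fgap_derive; lra.
  + auto_derive; [easy|ring].
- intros x hx. assert (h := dfgap_ge al x ha ltac:(lra)); lra.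
Qed.

Lemma fgap_le (al u w : R) : 1 < al -> 0 < u <= w -> fgap al u <= fgap al w.
Proof.
intros ha hu. assert (h := sgap_le al u w ha hu). unfold sgap in h. nra.
Qed.

Lemma hgap_le (al u w : R) : 1 < al -> 0 < u <= w -> hgap al u <= hgap al w.
Proof.
intros ha [hu huw].
apply nondecreasing_of_derive with (fun x => (al - 1) - dfgap al x); [lra| |].
- intros x hx. unfold hgap.
  apply (is_derive_minus (fun x => (al - 1) * x) (fgap al)).
  + auto_derive; [easy|ring].
  + apply fgap_derive; lra.
- intros x hx. assert (h := dfgap_le al x ha ltac:(lra)); lra.
Qed.

Lemma sgap_increment_le (al a b h : R) : 1 < al -> 0 < a <= b -> 0 <= h ->
  sgap al (a + h) - sgap al a <= sgap al (b + h) - sgap al b.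
Proof.
intros ha [h0 hab] hh.
apply (nondecreasing_of_derive (fun x => sgap al (x + h) - sgap al x)
         (fun x => dfgap al (x + h) - dfgap al x) a b hab).
- intros x hx. unfold sgap.
  assert (hf1 := fgap_derive al (x + h) ha ltac:(lra)).
  assert (hf2 := fgap_derive al x ha ltac:(lra)).
  auto_derive.
  + repeat split; [exists (dfgap al (x + h))|exists (dfgap al x)]; assumption.
  + replace (Derive (fun x0 => fgap al x0) (x + h)) with (dfgap al (x + h))
      by (symmetry; apply is_derive_unique; exact hf1).
    replace (Derive (fun x0 => fgap al x0) x) with (dfgap al x)
      by (symmetry; apply is_derive_unique; exact hf2).
    ring.
- intros x hx.
  assert (hm := dfgap_mono al x (x + h) ha ltac:(lra)); lra.
Qed.

(** First u moves to u' with w fixed: convexity of [sgap] raises [sgap al u - sgap al (u - w)]. Then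
    w moves to w': [sgap al w] grows and [sgap al (u' - w)] falls. *)
Lemma jgap_le (al u w u' w' : R) : 1 < al -> 0 < w < u ->
  u <= u' -> w <= w' -> w' < u' -> jgap al u w <= jgap al u' w'.
Proof.
intros ha hw hu hww hw'.
unfold jgap.
assert (h1 := sgap_increment_le al (u - w) (u' - w) w ha ltac:(lra) ltac:(lra)).
replace (u - w + w) with u in h1 by ring.
replace (u' - w + w) with u' in h1 by ring.
assert (h2 := sgap_le al w w' ha ltac:(lra)).
assert (h3 := sgap_le al (u' - w') (u' - w) ha ltac:(lra)).
lra.
Qed.

(** Regroups the increment of P in a left step into terms increasing in u and w. The next lemma does
    the same for a right step and isolates its loss [fgap al u]. *)
Lemma hgap_fgap_jgap (al u w : R) :
  hgap al (u - w) + fgap al w = hgap al u + jgap al u w.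
Proof. unfold hgap, jgap, sgap; lra. Qed.

Lemma opp_hgap_fgap_jgap (al u w : R) :
  - hgap al w - fgap al (u - w) = - fgap al u + jgap al u w.
Proof. unfold hgap, jgap, sgap; lra. Qed.

Lemma lgap_lt_inv (u u' : R) : 0 < u -> 0 < u' -> lgap u < lgap u' -> u < u'.
Proof.
intros hu hu' h.
assert (h1 := exp_gt_1 u hu). assert (h2 := exp_gt_1 u' hu').
apply ln_lt_inv in h; try lra.
apply exp_lt_inv; lra.
Qed.

Lemma exp_le_compat (x y : R) : x <= y -> exp x <= exp y.
Proof.
intros [h|h]; [left; now apply exp_increasing|right; now rewrite h].
Qed.

Lemma ln_le_compat (x y : R) : 0 < x -> x <= y -> ln x <= ln y.
Proof.
intros hx [h|h]; [left; now apply ln_increasing|right; now rewrite h].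
Qed.

(** Concavity of [lgap]. *)
Lemma lgap_shift_le (u w h : R) : 0 < w <= u -> 0 <= h ->
  lgap (u + h) - lgap u <= lgap (w + h) - lgap w.
Proof.
intros [hw hwu] hh.
assert (h1 := exp_gt_1 w hw). assert (h2 := exp_gt_1 u ltac:(lra)).
assert (h3 := exp_gt_1 (w + h) ltac:(lra)). assert (h4 := exp_gt_1 (u + h) ltac:(lra)).
assert (hle : exp w <= exp u) by (apply exp_le_compat; lra).
assert (hh1 : 1 <= exp h) by (rewrite <- exp_0; apply exp_le_compat; lra).
unfold lgap.
rewrite <- !ln_div by lra.
apply ln_le_compat; [apply Rdiv_lt_0_compat; lra|].
rewrite !exp_plus in *.
apply Rmult_le_reg_r with (exp u - 1); [lra|].
apply Rmult_le_reg_r with (exp w - 1); [lra|].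
field_simplify; try lra; nra.
Qed.

(* [u], [u2] are the logarithmic lengths of the gaps (n, n+2), (n+2, n+4) and [P], [P1] the Poincare coordinates at n and n+1; "left" means that |n| is the smallest of |n|, |n+2|, |n+4|, "right" that it is the largest. *)
Definition left_step (al u u2 P P1 : R) : Prop :=
  0 < u2 < u /\
  P1 = P + hgap al (u - u2) + fgap al u2 /\
  P = lgap u2 - ln (1 - exp (- (u - u2))).

Definition right_step (al u u2 P P1 : R) : Prop :=
  0 < u2 < u /\
  P1 = P - hgap al u2 - fgap al (u - u2) /\
  lgap u2 = lgap u - ln (1 + exp (- P)).

(** The value u2' is at least u2 + (u' - u), and by concavity of [lgap] this shift counts for more
    at u2 than at the larger u. *)
Lemma lgap_left_contract (u u2 u' u2' : R) :
  0 < u2 < u -> u <= u' -> u' - u2' <= u - u2 ->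
  lgap u' - lgap u <= lgap u2' - lgap u2.
Proof.
intros h1 h2 h3.
assert (h := lgap_shift_le u u2 (u' - u) ltac:(lra) ltac:(lra)).
replace (u + (u' - u)) with u' in h by ring.
assert (lgap (u2 + (u' - u)) <= lgap u2'); [|lra].
unfold lgap; apply ln_le_compat.
- assert (h4 := exp_gt_1 (u2 + (u' - u)) ltac:(lra)); lra.
- assert (h4 : exp (u2 + (u' - u)) <= exp u2') by (apply exp_le_compat; lra); lra.
Qed.

Lemma ln_one_sub_exp_le (k v v' : R) : 0 < k -> 0 < v <= v' ->
  ln (1 - exp (- (k * v))) <= ln (1 - exp (- (k * v'))).
Proof.
intros hk hv.
apply ln_le_compat.
- assert (exp (- (k * v)) < 1); [|lra].
  rewrite <- exp_0; apply exp_increasing; nra.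
- assert (exp (- (k * v')) <= exp (- (k * v))); [|lra].
  apply exp_le_compat; nra.
Qed.

(** * Comparison of single steps at two parameters *)

(** If u - u2 grows, use [lgap u2] = P + ln (1 - e^(-(u-u2))); otherwise [lgap_left_contract]
    applies. *)
Lemma left_step_lgap (al u u2 P P1 u' u2' P' P1' d : R) : 0 <= d ->
  left_step al u u2 P P1 -> left_step al u' u2' P' P1' ->
  d < lgap u' - lgap u -> d < P' - P -> d < lgap u2' - lgap u2.
Proof.
intros hd [h1 [_ h2]] [h1' [_ h2']] hL hP.
assert (hu := lgap_lt_inv u u' ltac:(lra) ltac:(lra) ltac:(lra)).
destruct (Rle_or_lt (u' - u2') (u - u2)) as [hv|hv].
- assert (h := lgap_left_contract u u2 u' u2' h1 ltac:(lra) hv); lra.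
- assert (h := ln_one_sub_exp_le 1 (u - u2) (u' - u2') ltac:(lra) ltac:(lra)).
  rewrite !Rmult_1_l in h; lra.
Qed.

Lemma right_step_lgap (al u u2 P P1 u' u2' P' P1' d : R) : 0 <= d ->
  right_step al u u2 P P1 -> right_step al u' u2' P' P1' ->
  d < lgap u' - lgap u -> d < P' - P -> d < lgap u2' - lgap u2.
Proof.
intros hd [h1 [_ h2]] [h1' [_ h2']] hL hP.
assert (ln (1 + exp (- P')) <= ln (1 + exp (- P))); [|lra].
assert (exp (- P') <= exp (- P)) by (apply exp_le_compat; lra).
pose proof (exp_pos (- P')).
apply ln_le_compat; lra.
Qed.

Lemma left_step_next (al u u2 P P1 u' u2' P' P1' : R) : 1 < al ->
  left_step al u u2 P P1 -> left_step al u' u2' P' P1' ->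
  u <= u' -> u2 <= u2' -> P' - P <= P1' - P1.
Proof.
intros ha [h1 [h2 _]] [h1' [h2' _]] hu hu2.
assert (e := hgap_fgap_jgap al u u2). assert (e' := hgap_fgap_jgap al u' u2').
assert (hh := hgap_le al u u' ha ltac:(lra)).
assert (hj := jgap_le al u u2 u' u2' ha h1 hu hu2 ltac:(lra)).
lra.
Qed.

Lemma right_step_next (al u u2 P P1 : R) :
  right_step al u u2 P P1 -> P1 = P - fgap al u + jgap al u u2.
Proof.
intros [_ [h _]]. assert (e := opp_hgap_fgap_jgap al u u2). lra.
Qed.

Lemma hgap_eq_ln (al v : R) : 0 < al -> 0 < v ->
  hgap al v = ln (1 - exp (- v)) - ln (1 - exp (- (al * v))).
Proof.
intros ha hv.
assert (h1 := exp_gt_1 v hv). assert (h2 := exp_gt_1_scaled al v ha hv).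
pose proof (exp_pos v). pose proof (exp_pos (al * v)).
assert (e1 : 1 - exp (- v) = (exp v - 1) * exp (- v)).
{ rewrite exp_Ropp; field; lra. }
assert (e2 : 1 - exp (- (al * v)) = (exp (al * v) - 1) * exp (- (al * v))).
{ rewrite exp_Ropp; field; lra. }
unfold hgap, fgap.
rewrite ln_div by lra.
rewrite e1, e2, !ln_mult by (try apply exp_pos; lra).
rewrite !ln_exp. ring.
Qed.

(* A growing gap ratio gives monotonicity through [hgap]; a shrinking one lets [P] be traded for [lgap u2]. *)
Lemma left_pair_shrink (al u u2 P P1 u' u2' P' P1' : R) : 1 < al ->
  left_step al u u2 P P1 -> left_step al u' u2' P' P1' ->
  u' - u2' <= u - u2 ->
  lgap u2' - lgap u2 <= P' + hgap al (u' - u2') - (P + hgap al (u - u2)).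
Proof.
intros ha [h1 [_ h2]] [h1' [_ h2']] hv.
rewrite !hgap_eq_ln by lra.
assert (h := ln_one_sub_exp_le al (u' - u2') (u - u2) ltac:(lra) ltac:(lra)).
lra.
Qed.

(** Bounds what is left of P after a left step at n once its gain [fgap al u2] is set against the
    equal loss of the right step at n+2. *)
Lemma left_pair (al u u2 P P1 u' u2' P' P1' d : R) : 1 < al -> 0 <= d ->
  left_step al u u2 P P1 -> left_step al u' u2' P' P1' ->
  d < lgap u' - lgap u -> d < P' - P ->
  d < P' + hgap al (u' - u2') - (P + hgap al (u - u2)).
Proof.
intros ha hd hs hs' hL hP.
assert (h1 : 0 < u2 < u) by apply hs. assert (h1' : 0 < u2' < u') by apply hs'.
assert (hu := lgap_lt_inv u u' ltac:(lra) ltac:(lra) ltac:(lra)).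
destruct (Rle_or_lt (u' - u2') (u - u2)) as [hv|hv].
- assert (h := left_pair_shrink _ _ _ _ _ _ _ _ _ ha hs hs' hv).
  assert (h3 := lgap_left_contract u u2 u' u2' h1 ltac:(lra) hv). lra.
- assert (h := hgap_le al (u - u2) (u' - u2') ha ltac:(lra)). lra.
Qed.

(** * Comparison of two whole trajectories *)

(** Since q_0 = 0, the gap at 0 is infinite: the equations for [P 0] and [P 1] are the limits of
    [left_step] as u tends to infinity, and [u 0] does not occur. *)
Definition trajectory (al : R) (u P : nat -> R) : Prop :=
  P 0%nat = lgap (u 2%nat) /\
  P 1%nat = P 0%nat + fgap al (u 2%nat) /\
  forall k : nat,
    right_step al (u (4*k+1)%nat) (u (4*k+3)%nat) (P (4*k+1)%nat) (P (4*k+2)%nat) /\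
    right_step al (u (4*k+2)%nat) (u (4*k+4)%nat) (P (4*k+2)%nat) (P (4*k+3)%nat) /\
    left_step al (u (4*k+3)%nat) (u (4*k+5)%nat) (P (4*k+3)%nat) (P (4*k+4)%nat) /\
    left_step al (u (4*k+4)%nat) (u (4*k+6)%nat) (P (4*k+4)%nat) (P (4*k+5)%nat).

(** The hypothesis on [P 0 - fgap al (u 1)] pays in advance for the unpartnered loss at index 1. The
    hypothesis over k pays for the loss at 4k+5 when the left step at 4k+4 has shrinking u - u2. The
    induction also carries [lgap] at 4k+2, 4k+3 and 4k+4, from which the next block starts. *)
Lemma trajectory_compare (al : R) (u P u' P' : nat -> R) (d : R) :
  1 < al -> 0 <= d -> trajectory al u P -> trajectory al u' P' ->
  d < lgap (u' 1%nat) - lgap (u 1%nat) ->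
  d < P' 0%nat - P 0%nat ->
  d < P' 0%nat - fgap al (u' 1%nat) - (P 0%nat - fgap al (u 1%nat)) ->
  (forall k : nat,
     u' (4*k+4)%nat - u' (4*k+6)%nat <= u (4*k+4)%nat - u (4*k+6)%nat ->
     u (4*k+2)%nat <= u' (4*k+2)%nat -> u (4*k+4)%nat <= u' (4*k+4)%nat ->
     u (4*k+5)%nat <= u' (4*k+5)%nat ->
     d < lgap (u' (4*k+2)%nat) - lgap (u (4*k+2)%nat) ->
     d < lgap (u' (4*k+5)%nat) - lgap (u (4*k+5)%nat) ->
     d < lgap (u' (4*k+6)%nat) - fgap al (u' (4*k+5)%nat)
         - (lgap (u (4*k+6)%nat) - fgap al (u (4*k+5)%nat))) ->
  forall n : nat, d < P' n - P n.
Proof.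
intros ha hd [e0 [e1 hT]] [e0' [e1' hT']] hL1 hP0 hB hS.
assert (mono : forall x y, d < lgap y - lgap x -> 0 < x -> 0 < y -> x <= y).
{ intros x y h hx hy; left; apply lgap_lt_inv; lra. }
assert (hinv : forall k : nat,
  (d < P' (4*k)%nat - P (4*k)%nat /\ d < P' (4*k+1)%nat - P (4*k+1)%nat /\
   d < P' (4*k+2)%nat - P (4*k+2)%nat /\ d < P' (4*k+3)%nat - P (4*k+3)%nat) /\
  d < lgap (u' (4*k+2)%nat) - lgap (u (4*k+2)%nat) /\
  d < lgap (u' (4*k+3)%nat) - lgap (u (4*k+3)%nat) /\
  d < lgap (u' (4*k+4)%nat) - lgap (u (4*k+4)%nat)).
{ induction k as [|k IH].
  - specialize (hT 0%nat). specialize (hT' 0%nat). simpl in *.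
    destruct hT as [r1 [r2 _]]. destruct hT' as [r1' [r2' _]].
    assert (q1 : 0 < u 3%nat < u 1%nat) by apply r1.
    assert (q1' : 0 < u' 3%nat < u' 1%nat) by apply r1'.
    assert (q2 : 0 < u 4%nat < u 2%nat) by apply r2.
    assert (q2' : 0 < u' 4%nat < u' 2%nat) by apply r2'.
    assert (hL2 : d < lgap (u' 2%nat) - lgap (u 2%nat)) by lra.
    assert (m1 := mono _ _ hL1 ltac:(lra) ltac:(lra)).
    assert (m2 := mono _ _ hL2 ltac:(lra) ltac:(lra)).
    assert (f2 := fgap_le al (u 2%nat) (u' 2%nat) ha ltac:(lra)).
    assert (hP1 : d < P' 1%nat - P 1%nat) by lra.
    assert (hL3 := right_step_lgap _ _ _ _ _ _ _ _ _ d hd r1 r1' hL1 hP1).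
    assert (m3 := mono _ _ hL3 ltac:(lra) ltac:(lra)).
    assert (j1 := jgap_le al _ _ _ _ ha q1 m1 m3 ltac:(lra)).
    assert (s1 := right_step_next _ _ _ _ _ r1).
    assert (s1' := right_step_next _ _ _ _ _ r1').
    assert (hP2 : d < P' 2%nat - P 2%nat) by lra.
    assert (hL4 := right_step_lgap _ _ _ _ _ _ _ _ _ d hd r2 r2' hL2 hP2).
    assert (m4 := mono _ _ hL4 ltac:(lra) ltac:(lra)).
    assert (j2 := jgap_le al _ _ _ _ ha q2 m2 m4 ltac:(lra)).
    assert (s2 := right_step_next _ _ _ _ _ r2).
    assert (s2' := right_step_next _ _ _ _ _ r2').
    (* The gain [fgap al (u 2)] at index 0 cancels the loss at index 2, so [P 3] is
       [P 0 - fgap al (u 1)] plus two [jgap] terms. *)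
    repeat split; lra.
  - destruct IH as [[_ [_ [_ hPj]]] [hL2 [hLj hLn]]].
    specialize (hS k).
    destruct (hT k) as [_ [ra [lj lb]]]. destruct (hT' k) as [_ [ra' [lj' lb']]].
    specialize (hT (S k)). specialize (hT' (S k)).
    replace (4 * S k)%nat with (4*k+4)%nat in * by lia.
    replace (4*k+4+1)%nat with (4*k+5)%nat in * by lia.
    replace (4*k+4+2)%nat with (4*k+6)%nat in * by lia.
    replace (4*k+4+3)%nat with (4*k+7)%nat in * by lia.
    replace (4*k+4+4)%nat with (4*k+8)%nat in * by lia.
    destruct hT as [r5 [r6 _]]. destruct hT' as [r5' [r6' _]].
    assert (q2 : 0 < u (4*k+4)%nat < u (4*k+2)%nat) by apply ra.
    assert (q2' : 0 < u' (4*k+4)%nat < u' (4*k+2)%nat) by apply ra'.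
    assert (q3 : 0 < u (4*k+5)%nat < u (4*k+3)%nat) by apply lj.
    assert (q3' : 0 < u' (4*k+5)%nat < u' (4*k+3)%nat) by apply lj'.
    assert (q4 : 0 < u (4*k+6)%nat < u (4*k+4)%nat) by apply lb.
    assert (q4' : 0 < u' (4*k+6)%nat < u' (4*k+4)%nat) by apply lb'.
    assert (q5 : 0 < u (4*k+7)%nat < u (4*k+5)%nat) by apply r5.
    assert (q5' : 0 < u' (4*k+7)%nat < u' (4*k+5)%nat) by apply r5'.
    assert (q6 : 0 < u (4*k+8)%nat < u (4*k+6)%nat) by apply r6.
    assert (q6' : 0 < u' (4*k+8)%nat < u' (4*k+6)%nat) by apply r6'.
    assert (m2 := mono _ _ hL2 ltac:(lra) ltac:(lra)).
    assert (m3 := mono _ _ hLj ltac:(lra) ltac:(lra)).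
    assert (m4 := mono _ _ hLn ltac:(lra) ltac:(lra)).
    assert (hL5 := left_step_lgap _ _ _ _ _ _ _ _ _ d hd lj lj' hLj hPj).
    assert (m5 := mono _ _ hL5 ltac:(lra) ltac:(lra)).
    assert (hPn := left_step_next _ _ _ _ _ _ _ _ _ ha lj lj' m3 m5).
    assert (hL6 := left_step_lgap _ _ _ _ _ _ _ _ _ d hd lb lb' hLn ltac:(lra)).
    assert (m6 := mono _ _ hL6 ltac:(lra) ltac:(lra)).
    assert (hP5 := left_step_next _ _ _ _ _ _ _ _ _ ha lb lb' m4 m6).
    assert (hL7 := right_step_lgap _ _ _ _ _ _ _ _ _ d hd r5 r5' hL5 ltac:(lra)).
    assert (m7 := mono _ _ hL7 ltac:(lra) ltac:(lra)).
    assert (j5 := jgap_le al _ _ _ _ ha q5 m5 m7 ltac:(lra)).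
    assert (s5 := right_step_next _ _ _ _ _ r5).
    assert (s5' := right_step_next _ _ _ _ _ r5').
    assert (pj := left_pair _ _ _ _ _ _ _ _ _ d ha hd lj lj' hLj hPj).
    assert (ej : P (4*k+4)%nat = P (4*k+3)%nat
      + hgap al (u (4*k+3)%nat - u (4*k+5)%nat) + fgap al (u (4*k+5)%nat)) by apply lj.
    assert (ej' : P' (4*k+4)%nat = P' (4*k+3)%nat
      + hgap al (u' (4*k+3)%nat - u' (4*k+5)%nat) + fgap al (u' (4*k+5)%nat)) by apply lj'.
    assert (en : P (4*k+5)%nat = P (4*k+4)%nat
      + hgap al (u (4*k+4)%nat - u (4*k+6)%nat) + fgap al (u (4*k+6)%nat)) by apply lb.
    assert (en' : P' (4*k+5)%nat = P' (4*k+4)%nat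
      + hgap al (u' (4*k+4)%nat - u' (4*k+6)%nat) + fgap al (u' (4*k+6)%nat)) by apply lb'.
    (* The loss at 4k+5 cancels the [fgap] gain of the left step at 4k+3; [pj] bounds the rest. *)
    assert (hP6 : d < P' (4*k+6)%nat - P (4*k+6)%nat) by lra.
    assert (hL8 := right_step_lgap _ _ _ _ _ _ _ _ _ d hd r6 r6' hL6 hP6).
    assert (m8 := mono _ _ hL8 ltac:(lra) ltac:(lra)).
    assert (j6 := jgap_le al _ _ _ _ ha q6 m6 m8 ltac:(lra)).
    assert (s6 := right_step_next _ _ _ _ _ r6).
    assert (s6' := right_step_next _ _ _ _ _ r6').
    (* The loss at 4k+6 cancels the [fgap] gain at 4k+4. If u - u2 grows there, its [hgap] grows and
       [pj] is used again. If it shrinks, P at 4k+4 plus this [hgap] is traded for [lgap] at 4k+6,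
       and [hS] covers the loss at 4k+5. *)
    assert (hP7 : d < P' (4*k+7)%nat - P (4*k+7)%nat).
    { destruct (Rle_or_lt (u' (4*k+4)%nat - u' (4*k+6)%nat)
                          (u (4*k+4)%nat - u (4*k+6)%nat)) as [hv|hv].
      - assert (h1 := left_pair_shrink _ _ _ _ _ _ _ _ _ ha lb lb' hv).
        assert (h2 := hS hv m2 m4 m5 hL2 hL5). lra.
      - assert (h1 := hgap_le al (u (4*k+4)%nat - u (4*k+6)%nat)
          (u' (4*k+4)%nat - u' (4*k+6)%nat) ha ltac:(lra)). lra. }
    repeat split; lra. }
intros n.
assert (hn := hinv (n / 4)%nat).
assert (hm := Nat.mod_upper_bound n 4 ltac:(lia)).
assert (hd4 := Nat.div_mod n 4 ltac:(lia)).
destruct hn as [[h0 [h1 [h2 h3]]] _].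
destruct (n mod 4)%nat as [|[|[|[|m]]]].
- replace n with (4 * (n / 4))%nat by lia; assumption.
- replace n with (4 * (n / 4) + 1)%nat by lia; assumption.
- replace n with (4 * (n / 4) + 2)%nat by lia; assumption.
- replace n with (4 * (n / 4) + 3)%nat by lia; assumption.
- lia.
Qed.

(** * Steps realized by a power followed by an affine map *)

Lemma exp_scaled_ln_diff (al x y : R) : 0 < x -> 0 < y ->
  exp (al * (ln x - ln y)) = Rpower x al / Rpower y al.
Proof.
intros hx hy. unfold Rpower, Rdiv.
rewrite <- exp_Ropp, <- exp_plus. f_equal; ring.
Qed.

Lemma exp_ln_diff (x y : R) : 0 < x -> 0 < y -> exp (ln x - ln y) = x / y.
Proof.
intros hx hy. rewrite <- ln_div by lra. apply exp_ln, Rdiv_lt_0_compat; lra.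
Qed.

Lemma lgap_ln_diff (x y : R) : 0 < y < x -> lgap (ln x - ln y) = ln (x - y) - ln y.
Proof.
intros h. unfold lgap. rewrite exp_ln_diff, <- ln_div by lra.
f_equal; field; lra.
Qed.

Lemma fgap_ln_diff (al x y : R) : 0 < al -> 0 < y < x ->
  fgap al (ln x - ln y)
  = ln (Rpower x al - Rpower y al) - ln (Rpower y al) - (ln (x - y) - ln y).
Proof.
intros ha h.
assert (hp : Rpower y al < Rpower x al) by (apply Rlt_Rpower_l; lra).
assert (h0 : 0 < Rpower y al) by apply exp_pos.
unfold fgap. rewrite exp_scaled_ln_diff, exp_ln_diff by lra.
replace ((Rpower x al / Rpower y al - 1) / (x / y - 1))
  with ((Rpower x al - Rpower y al) / Rpower y al / ((x - y) / y)) by (field; lra).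
rewrite !ln_div by (try apply Rdiv_lt_0_compat; lra).
reflexivity.
Qed.

(** Both gaps are measured relative to the middle point b: the upper one changes by [fgap], the
    lower one, whose upper end is b, by [- hgap]. *)
Lemma Rpower_gap (al a b d : R) : 0 < al -> 0 < a < b -> b < d ->
  ln ((Rpower d al - Rpower b al) / (Rpower b al - Rpower a al))
  = ln ((d - b) / (b - a)) + hgap al (ln b - ln a) + fgap al (ln d - ln b).
Proof.
intros hal hab hbd.
assert (hp : Rpower a al < Rpower b al) by (apply Rlt_Rpower_l; lra).
assert (hq : Rpower b al < Rpower d al) by (apply Rlt_Rpower_l; lra).
unfold hgap. rewrite !fgap_ln_diff by lra.
rewrite !ln_div by lra.
assert (e : forall z, ln (Rpower z al) = al * ln z) by (intros; apply ln_exp).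
rewrite !e. ring.
Qed.

Lemma affine_ratio (c e x y z : R) : e <> 0 -> x <> y ->
  (c + e * y - (c + e * z)) / (c + e * x - (c + e * y)) = (y - z) / (x - y).
Proof.
intros he hxy.
replace (c + e * y - (c + e * z)) with (e * (y - z)) by ring.
replace (c + e * x - (c + e * y)) with (e * (x - y)) by ring.
field; lra.
Qed.

(** Here a, b, d stand for q_n, q_{n+4}, q_{n+2}; in [right_step_intro], p, x, q stand for q_{n+2},
    q_{n+4}, q_n. The affine part c + e x cancels in the ratio. *)
Lemma left_step_intro (al a b d c e : R) : 0 < al -> 0 < a < b -> b < d -> e <> 0 ->
  left_step al (ln d - ln a) (ln d - ln b) (ln ((b - d) / (a - b)))
    (ln ((c + e * Rpower b al - (c + e * Rpower d al))
         / (c + e * Rpower a al - (c + e * Rpower b al)))).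
Proof.
intros hal hab hbd he.
assert (hp : Rpower a al < Rpower b al) by (apply Rlt_Rpower_l; lra).
assert (h1 : ln a < ln b) by (apply ln_increasing; lra).
assert (h2 : ln b < ln d) by (apply ln_increasing; lra).
replace ((b - d) / (a - b)) with ((d - b) / (b - a)) by (field; lra).
assert (hq : Rpower b al < Rpower d al) by (apply Rlt_Rpower_l; lra).
rewrite affine_ratio by lra.
replace ((Rpower b al - Rpower d al) / (Rpower a al - Rpower b al))
  with ((Rpower d al - Rpower b al) / (Rpower b al - Rpower a al)) by (field; lra).
replace (ln d - ln a - (ln d - ln b)) with (ln b - ln a) by ring.
repeat split.
- lra.
- lra.
- replace (ln d - ln a - (ln d - ln b)) with (ln b - ln a) by ring.
  apply Rpower_gap; lra.
- replace (- (ln d - ln a - (ln d - ln b))) with (ln a - ln b) by ring.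
  rewrite lgap_ln_diff, exp_ln_diff by lra.
  replace (1 - a / b) with ((b - a) / b) by (field; lra).
  rewrite !ln_div by lra. ring.
Qed.

Lemma right_step_intro (al p x q c e : R) : 0 < al -> 0 < p < x -> x < q -> e <> 0 ->
  right_step al (ln q - ln p) (ln x - ln p) (ln ((x - p) / (q - x)))
    (ln ((c + e * Rpower x al - (c + e * Rpower p al))
         / (c + e * Rpower q al - (c + e * Rpower x al)))).
Proof.
intros hal hpx hxq he.
assert (hp : Rpower p al < Rpower x al) by (apply Rlt_Rpower_l; lra).
assert (hq : Rpower x al < Rpower q al) by (apply Rlt_Rpower_l; lra).
assert (h1 : ln p < ln x) by (apply ln_increasing; lra).
assert (h2 : ln x < ln q) by (apply ln_increasing; lra).
assert (hg := Rpower_gap al p x q hal hpx hxq).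
repeat split.
- lra.
- lra.
- replace (ln q - ln p - (ln x - ln p)) with (ln q - ln x) by ring.
  rewrite affine_ratio by lra.
  replace ((Rpower x al - Rpower p al) / (Rpower q al - Rpower x al))
    with (/ ((Rpower q al - Rpower x al) / (Rpower x al - Rpower p al))) by (field; lra).
  replace ((x - p) / (q - x)) with (/ ((q - x) / (x - p))) by (field; lra).
  rewrite !ln_Rinv by (apply Rdiv_lt_0_compat; lra).
  lra.
- rewrite !lgap_ln_diff by lra.
  rewrite <- ln_Rinv by (apply Rdiv_lt_0_compat; lra).
  rewrite exp_ln by (apply Rinv_0_lt_compat, Rdiv_lt_0_compat; lra).
  replace (1 + / ((x - p) / (q - x))) with ((q - p) / (x - p)) by (field; lra).
  rewrite ln_div by lra. ring.
Qed.

(** * Absolute values of a rescaled orbit of type RLRL *)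

(** The blocks of four follow the period of the order pattern of q_n, q_{n+2}, q_{n+4}. The value
    q_1 = 1 is given separately because [Rpower 0 al] is not 0. *)
Definition rl_orbit (al t : R) (q : nat -> R) : Prop :=
  0 < t /\ q 0%nat = 0 /\ q 1%nat = 1 /\ (forall n : nat, 0 < q (S n)) /\
  forall k : nat,
    q (4*k+2)%nat = -1 + t * Rpower (q (4*k+1)%nat) al /\
    q (4*k+3)%nat = 1 + - t * Rpower (q (4*k+2)%nat) al /\
    q (4*k+4)%nat = -1 + t * Rpower (q (4*k+3)%nat) al /\
    q (4*k+5)%nat = 1 + - t * Rpower (q (4*k+4)%nat) al.

Definition gap (q : nat -> R) (n : nat) : R := Rabs (ln (q n) - ln (q (n+2)%nat)).
Definition pcoord (q : nat -> R) (n : nat) : R :=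
  ln ((q (n+4)%nat - q (n+2)%nat) / (q n - q (n+4)%nat)).

(** Index 0 is excluded, as q_0 = 0. Accordingly [gap q 0] contains the default value of ln 0;
    [trajectory] does not refer to it. *)
Lemma rl_orbit_pos (al t : R) (q : nat -> R) (n : nat) :
  rl_orbit al t q -> (1 <= n)%nat -> 0 < q n.
Proof.
intros [_ [_ [_ [h _]]]] hn. destruct n as [|n]; [lia|apply h].
Qed.

(** The order at n is carried to n+1 by the map of index n, which preserves order for odd n and
    reverses it for even n. The start comes from q_0 = 0 and from q_3, q_5 < 1 = q_1. *)
Lemma rl_orbit_order (al t : R) (q : nat -> R) (k : nat) :
  0 < al -> rl_orbit al t q ->
  (q (4*k)%nat < q (4*k+4)%nat < q (4*k+2)%nat) /\
  (q (4*k+3)%nat < q (4*k+5)%nat < q (4*k+1)%nat) /\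
  (q (4*k+4)%nat < q (4*k+6)%nat < q (4*k+2)%nat) /\
  (q (4*k+3)%nat < q (4*k+7)%nat < q (4*k+5)%nat).
Proof.
intros hal hq.
assert (hpos := fun n => rl_orbit_pos al t q n hq).
destruct hq as [ht [h0 [h1 [_ hd]]]].
assert (hpw : forall x y, 0 < x -> x < y -> t * Rpower x al < t * Rpower y al).
{ intros x y hx hxy. apply Rmult_lt_compat_l; [lra|].
  apply Rlt_Rpower_l; lra. }
assert (hpp : forall x, 0 < t * Rpower x al).
{ intros x; apply Rmult_lt_0_compat; [lra|apply exp_pos]. }
induction k as [|k IH].
- destruct (hd 0%nat) as [e2 [e3 [e4 e5]]]. destruct (hd 1%nat) as [e6 [e7 _]].
  simpl in *.
  assert (p2 := hpos 2%nat ltac:(lia)). assert (p3 := hpos 3%nat ltac:(lia)).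
  assert (p4 := hpos 4%nat ltac:(lia)). assert (p5 := hpos 5%nat ltac:(lia)).
  assert (p6 := hpos 6%nat ltac:(lia)).
  pose proof (hpp (q 2%nat)). pose proof (hpp (q 4%nat)).
  assert (i1 : q 4%nat < q 2%nat).
  { assert (j := hpw (q 3%nat) (q 1%nat) p3 ltac:(lra)). lra. }
  assert (i2 : q 3%nat < q 5%nat).
  { assert (j := hpw _ _ p4 i1). lra. }
  assert (i3 : q 5%nat < q 1%nat) by lra.
  assert (j1 := hpw _ _ p3 i2). assert (j2 := hpw _ _ p5 i3).
  assert (i4 : q 4%nat < q 6%nat < q 2%nat) by lra.
  assert (j3 := hpw _ _ p4 (proj1 i4)). assert (j4 := hpw _ _ p6 (proj2 i4)).
  repeat split; lra.
- destruct IH as [_ [_ [i6 i7]]].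
  destruct (hd k) as [_ [e3 [e4 e5]]]. destruct (hd (S k)) as [e6 [e7 [e8 e9]]].
  destruct (hd (S (S k))) as [e10 [e11 _]].
  replace (4 * S (S k))%nat with (4*k+8)%nat in * by lia.
  replace (4 * S k)%nat with (4*k+4)%nat in * by lia.
  replace (4*k+4+1)%nat with (4*k+5)%nat in * by lia.
  replace (4*k+4+2)%nat with (4*k+6)%nat in * by lia.
  replace (4*k+4+3)%nat with (4*k+7)%nat in * by lia.
  replace (4*k+4+4)%nat with (4*k+8)%nat in * by lia.
  replace (4*k+4+5)%nat with (4*k+9)%nat in * by lia.
  replace (4*k+4+6)%nat with (4*k+10)%nat in * by lia.
  replace (4*k+4+7)%nat with (4*k+11)%nat in * by lia.
  replace (4*k+8+1)%nat with (4*k+9)%nat in * by lia.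
  replace (4*k+8+2)%nat with (4*k+10)%nat in * by lia.
  replace (4*k+8+3)%nat with (4*k+11)%nat in * by lia.
  assert (p3 := hpos (4*k+3)%nat ltac:(lia)). assert (p4 := hpos (4*k+4)%nat ltac:(lia)).
  assert (p5 := hpos (4*k+5)%nat ltac:(lia)). assert (p6 := hpos (4*k+6)%nat ltac:(lia)).
  assert (p7 := hpos (4*k+7)%nat ltac:(lia)). assert (p8 := hpos (4*k+8)%nat ltac:(lia)).
  assert (p9 := hpos (4*k+9)%nat ltac:(lia)). assert (p10 := hpos (4*k+10)%nat ltac:(lia)).
  assert (j1 := hpw _ _ p3 (proj1 i7)). assert (j2 := hpw _ _ p7 (proj2 i7)).
  assert (i8 : q (4*k+4)%nat < q (4*k+8)%nat < q (4*k+6)%nat) by lra.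
  assert (j3 := hpw _ _ p4 (proj1 i8)). assert (j4 := hpw _ _ p8 (proj2 i8)).
  assert (i9 : q (4*k+7)%nat < q (4*k+9)%nat < q (4*k+5)%nat) by lra.
  assert (j5 := hpw _ _ p7 (proj1 i9)). assert (j6 := hpw _ _ p9 (proj2 i9)).
  assert (i10 : q (4*k+8)%nat < q (4*k+10)%nat < q (4*k+6)%nat) by lra.
  assert (j7 := hpw _ _ p8 (proj1 i10)). assert (j8 := hpw _ _ p10 (proj2 i10)).
  repeat split; lra.
Qed.

Lemma gap_increasing (q : nat -> R) (n m : nat) :
  m = (n + 2)%nat -> 0 < q n < q m -> gap q n = ln (q m) - ln (q n).
Proof.
intros -> h. unfold gap.
assert (ln (q n) < ln (q (n+2)%nat)) by (apply ln_increasing; lra).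
rewrite Rabs_left; lra.
Qed.

Lemma gap_decreasing (q : nat -> R) (n m : nat) :
  m = (n + 2)%nat -> 0 < q m < q n -> gap q n = ln (q n) - ln (q m).
Proof.
intros -> h. unfold gap.
assert (ln (q (n+2)%nat) < ln (q n)) by (apply ln_increasing; lra).
rewrite Rabs_right; lra.
Qed.

Lemma rl_orbit_trajectory (al t : R) (q : nat -> R) :
  0 < al -> rl_orbit al t q -> trajectory al (gap q) (pcoord q).
Proof.
intros hal hq.
assert (hord := fun k => rl_orbit_order al t q k hal hq).
assert (hpos := fun n => rl_orbit_pos al t q n hq).
destruct hq as [ht [h0 [h1 [_ hd]]]].
assert (hstepL : forall n m b c e, m = (n+2)%nat -> b = (n+4)%nat ->
  0 < q n -> q n < q b < q m -> e <> 0 ->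
  q (n+1)%nat = c + e * Rpower (q n) al ->
  q (n+3)%nat = c + e * Rpower (q m) al ->
  q (n+5)%nat = c + e * Rpower (q b) al ->
  forall n1, n1 = (n+1)%nat ->
  left_step al (gap q n) (gap q m) (pcoord q n) (pcoord q n1)).
{ intros n m b c e -> -> hn hb he e1 e3 e5 n1 ->.
  rewrite (gap_increasing q n (n+2)), (gap_decreasing q (n+2) (n+4)) by (lia || lra).
  unfold pcoord.
  replace (n+1+4)%nat with (n+5)%nat by lia. replace (n+1+2)%nat with (n+3)%nat by lia.
  rewrite e1, e3, e5. apply left_step_intro; lra. }
assert (hstepR : forall n m b c e, m = (n+2)%nat -> b = (n+4)%nat ->
  0 < q m -> q m < q b < q n -> e <> 0 ->
  q (n+1)%nat = c + e * Rpower (q n) al ->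
  q (n+3)%nat = c + e * Rpower (q m) al ->
  q (n+5)%nat = c + e * Rpower (q b) al ->
  forall n1, n1 = (n+1)%nat ->
  right_step al (gap q n) (gap q m) (pcoord q n) (pcoord q n1)).
{ intros n m b c e -> -> hn hb he e1 e3 e5 n1 ->.
  rewrite (gap_decreasing q n (n+2)), (gap_increasing q (n+2) (n+4)) by (lia || lra).
  unfold pcoord.
  replace (n+1+4)%nat with (n+5)%nat by lia. replace (n+1+2)%nat with (n+3)%nat by lia.
  rewrite e1, e3, e5. apply right_step_intro; lra. }
split; [|split].
- destruct (hord 0%nat) as [o1 _]. simpl in o1.
  unfold pcoord; simpl. rewrite (gap_decreasing q 2 4) by (lia || lra).
  rewrite lgap_ln_diff, h0 by lra.
  rewrite <- ln_div by lra. f_equal; field; lra.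
- destruct (hord 0%nat) as [o1 _]. destruct (hd 0%nat) as [_ [e3 [_ e5]]].
  simpl in o1, e3, e5.
  unfold pcoord; simpl. rewrite (gap_decreasing q 2 4) by (lia || lra).
  rewrite fgap_ln_diff, e3, e5, h0, h1 by lra.
  assert (hp : Rpower (q 4%nat) al < Rpower (q 2%nat) al) by (apply Rlt_Rpower_l; lra).
  assert (hp0 : 0 < Rpower (q 4%nat) al) by apply exp_pos.
  rewrite <- !ln_div by lra.
  replace ((1 + - t * Rpower (q 4%nat) al - (1 + - t * Rpower (q 2%nat) al))
           / (1 - (1 + - t * Rpower (q 4%nat) al)))
    with ((Rpower (q 2%nat) al - Rpower (q 4%nat) al) / Rpower (q 4%nat) al)
    by (field; nra).
  replace ((q 4%nat - q 2%nat) / (0 - q 4%nat))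
    with ((q 2%nat - q 4%nat) / q 4%nat) by (field; lra).
  ring.
- intros k.
  destruct (hord k) as [o1 [o2 [o3 o4]]]. destruct (hord (S k)) as [o5 [o6 _]].
  destruct (hd k) as [e2 [e3 [e4 e5]]]. destruct (hd (S k)) as [e6 [e7 [e8 e9]]].
  assert (p3 := hpos (4*k+3)%nat ltac:(lia)). assert (p4 := hpos (4*k+4)%nat ltac:(lia)).
  replace (4 * S k)%nat with (4*k+4)%nat in * by lia.
  replace (4*k+4+1)%nat with (4*k+5)%nat in * by lia.
  replace (4*k+4+2)%nat with (4*k+6)%nat in * by lia.
  replace (4*k+4+3)%nat with (4*k+7)%nat in * by lia.
  replace (4*k+4+4)%nat with (4*k+8)%nat in * by lia.
  replace (4*k+4+5)%nat with (4*k+9)%nat in * by lia.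
  split; [|split; [|split]].
  + apply (hstepR (4*k+1)%nat (4*k+3)%nat (4*k+5)%nat (-1) t); try lia; try lra;
      rewrite <- Nat.add_assoc; assumption.
  + apply (hstepR (4*k+2)%nat (4*k+4)%nat (4*k+6)%nat 1 (-t)); try lia; try lra;
      rewrite <- Nat.add_assoc; assumption.
  + apply (hstepL (4*k+3)%nat (4*k+5)%nat (4*k+7)%nat (-1) t); try lia; try lra;
      rewrite <- Nat.add_assoc; assumption.
  + apply (hstepL (4*k+4)%nat (4*k+6)%nat (4*k+8)%nat 1 (-t)); try lia; try lra;
      rewrite <- Nat.add_assoc; assumption.
Qed.

(** * Payment for the loss at the indices 4k+5 *)

(** The expression is the logarithm of the chord slope of x^al between e^p and e^r. It equals (al-1)
    r - [hgap al (r - p)], so it grows with r through [fgap] and with p through [hgap]. *)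
Lemma fgap_corner_le (al p r p' r' : R) : 1 < al -> p < r -> p' < r' ->
  p <= p' -> r <= r' ->
  (al - 1) * p + fgap al (r - p) <= (al - 1) * p' + fgap al (r' - p').
Proof.
intros ha h h' hp hr.
assert (h1 := fgap_le al (r - p) (r' - p) ha ltac:(lra)).
assert (h2 := hgap_le al (r' - p') (r' - p) ha ltac:(lra)).
unfold hgap in h2. lra.
Qed.

Lemma ln_affine_power (al t x y : R) : 0 < t -> y = -1 + t * Rpower x al ->
  ln (1 + y) = ln t + al * ln x.
Proof.
intros ht ->.
replace (1 + (-1 + t * Rpower x al)) with (t * Rpower x al) by ring.
rewrite ln_mult by (try apply exp_pos; lra).
unfold Rpower; rewrite ln_exp; reflexivity.
Qed.

Lemma ln_affine_power_diff (al t c e x y x1 y1 : R) : 0 < t -> 0 < al -> 0 < y < x ->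
  c <> 0 -> x1 = e + c * Rpower x al -> y1 = e + c * Rpower y al -> Rabs c = t ->
  ln (Rabs (x1 - y1))
  = ln t + ((al - 1) * ln y + fgap al (ln x - ln y)) + ln (x - y).
Proof.
intros ht hal hxy hc -> -> hct.
assert (hp : Rpower y al < Rpower x al) by (apply Rlt_Rpower_l; lra).
replace (e + c * Rpower x al - (e + c * Rpower y al))
  with (c * (Rpower x al - Rpower y al)) by ring.
rewrite Rabs_mult, hct, (Rabs_right (Rpower x al - Rpower y al)), ln_mult by lra.
rewrite fgap_ln_diff by lra.
assert (e1 : ln (Rpower y al) = al * ln y) by apply ln_exp.
rewrite e1; ring.
Qed.

(* The two sides are the points of the orbit at n-2, n, n+2, n+4 (even) and n-1, n+1, n+3 (odd), for n divisible by 4. *)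
Definition window (al t a b c e x3 x5 x7 : R) : Prop :=
  0 < t /\ 0 < b < e /\ e < c /\ c < a /\ 0 < x3 < x7 /\ x7 < x5 /\
  x3 = 1 + - t * Rpower a al /\ b = -1 + t * Rpower x3 al /\
  x5 = 1 + - t * Rpower b al /\ c = -1 + t * Rpower x5 al /\
  e = -1 + t * Rpower x7 al.

(** As c - e = t (x5^al - x7^al) and 1 + e = t x7^al, the logarithm of (c-e)/(1+e) is [lgap] plus
    [fgap] of ln (x5/x7). Measuring c - e relative to e instead brings in the factor 1 + 1/e. *)
Lemma window_transfer (al t a b c e x3 x5 x7 : R) :
  1 < al -> window al t a b c e x3 x5 x7 ->
  lgap (ln c - ln e) - fgap al (ln x5 - ln x7)
  = lgap (ln x5 - ln x7) + ln (1 + / e).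
Proof.
intros ha [ht [hb [he [hc [hx3 [hx7 [_ [_ [_ [e5 e7]]]]]]]]]].
assert (hp : Rpower x7 al < Rpower x5 al) by (apply Rlt_Rpower_l; lra).
assert (hp0 : 0 < Rpower x7 al) by apply exp_pos.
rewrite fgap_ln_diff, !lgap_ln_diff by lra.
assert (h1 : ln (c - e) = ln t + ln (Rpower x5 al - Rpower x7 al)).
{ rewrite <- ln_mult by lra. f_equal; lra. }
assert (h2 : ln (1 + / e) = ln t + ln (Rpower x7 al) - ln e).
{ rewrite <- ln_mult, <- ln_div by nra. f_equal.
  replace (t * Rpower x7 al) with (1 + e) by lra. field; lra. }
lra.
Qed.

(** The ratio (c-b)/(a-b) is a product of two chord slopes, since [b,a] is mapped to [x3,x5] and
    this to [b,c]. *)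
Lemma window_growth (al t a b c e x3 x5 x7 : R) :
  1 < al -> window al t a b c e x3 x5 x7 ->
  lgap (ln c - ln b) - lgap (ln a - ln b)
  = 2 * ln t + ((al - 1) * ln x3 + fgap al (ln x5 - ln x3))
    + ((al - 1) * ln b + fgap al (ln a - ln b)).
Proof.
intros ha [ht [hb [he [hc [hx3 [hx7 [e3 [e4 [e5 [e6 _]]]]]]]]]].
rewrite !lgap_ln_diff by lra.
assert (h1 := ln_affine_power_diff al t t (-1) x5 x3 c b ht ltac:(lra) ltac:(lra)
  ltac:(lra) e6 e4 (Rabs_right t ltac:(lra))).
assert (h2 := ln_affine_power_diff al t (- t) 1 a b x3 x5 ht ltac:(lra) ltac:(lra)
  ltac:(lra) e3 e5 ltac:(rewrite Rabs_Ropp; apply Rabs_right; lra)).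
rewrite Rabs_right in h1 by lra.
rewrite Rabs_left in h2 by lra.
replace (- (x3 - x5)) with (x5 - x3) in h2 by ring.
lra.
Qed.

Lemma le_of_ln_le (x y : R) : 0 < x -> 0 < y -> ln x <= ln y -> x <= y.
Proof.
intros hx hy h. rewrite <- (exp_ln x), <- (exp_ln y) by lra. now apply exp_le_compat.
Qed.

(* When the gap ratio |n+4|/|n| decreases, the loss at the odd index n+1 is paid either by the odd gap coordinate (|n+4| decreasing) or by the growth of r at n-2, which is at least (t'/t)^(1+1/al) because |n| and |n+2| increase. *)
Lemma window_compare (al d t a b c e x3 x5 x7 t' a' b' c' e' x3' x5' x7' : R) :
  1 < al -> t < t' ->
  window al t a b c e x3 x5 x7 -> window al t' a' b' c' e' x3' x5' x7' ->
  ln e' - ln b' <= ln e - ln b ->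
  ln a - ln b <= ln a' - ln b' -> ln c - ln b <= ln c' - ln b' ->
  ln x5 - ln x7 <= ln x5' - ln x7' ->
  d < lgap (ln a' - ln b') - lgap (ln a - ln b) ->
  d < lgap (ln x5' - ln x7') - lgap (ln x5 - ln x7) ->
  d < lgap (ln c' - ln e') - fgap al (ln x5' - ln x7')
      - (lgap (ln c - ln e) - fgap al (ln x5 - ln x7)).
Proof.
intros ha htt hw hw' hv hu2 hu4 hu5 hL2 hL5.
assert (T := window_transfer _ _ _ _ _ _ _ _ _ ha hw).
assert (T' := window_transfer _ _ _ _ _ _ _ _ _ ha hw').
assert (Q := window_growth _ _ _ _ _ _ _ _ _ ha hw).
assert (Q' := window_growth _ _ _ _ _ _ _ _ _ ha hw').
destruct hw as [ht [hb [he [hc [hx3 [hx7 [e3 [e4 [e5 [e6 e7]]]]]]]]]].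
destruct hw' as [ht' [hb' [he' [hc' [hx3' [hx7' [e3' [e4' [e5' [e6' e7']]]]]]]]]].
destruct (Rle_or_lt e' e) as [hee|hee].
- assert (ln (1 + / e) <= ln (1 + / e')); [|lra].
  assert (/ e <= / e') by (apply Rinv_le_contravar; lra).
  assert (0 < / e) by (apply Rinv_0_lt_compat; lra).
  apply ln_le_compat; lra.
- assert (hle : ln e < ln e') by (apply ln_increasing; lra).
  assert (hbb : b <= b') by (apply le_of_ln_le; lra).
  assert (hcc : c <= c') by (apply le_of_ln_le; lra).
  assert (m3 := ln_affine_power _ _ _ _ ht e4). assert (m3' := ln_affine_power _ _ _ _ ht' e4').
  assert (m5 := ln_affine_power _ _ _ _ ht e6). assert (m5' := ln_affine_power _ _ _ _ ht' e6').
  assert (m7 := ln_affine_power _ _ _ _ ht e7). assert (m7' := ln_affine_power _ _ _ _ ht' e7').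
  assert (i3 : ln (1 + b) <= ln (1 + b')) by (apply ln_le_compat; lra).
  assert (i5 : ln (1 + c) <= ln (1 + c')) by (apply ln_le_compat; lra).
  assert (i7 : ln (1 + e) <= ln (1 + e')) by (apply ln_le_compat; lra).
  assert (hx5 : ln x5' <= ln x5).
  { assert (hp : Rpower b al <= Rpower b' al) by (apply Rle_Rpower_l; lra).
    assert (0 < Rpower b al) by apply exp_pos.
    apply ln_le_compat; nra. }
  assert (hax5 : al * ln x5' <= al * ln x5) by (apply Rmult_le_compat_l; lra).
  set (tau := ln t' - ln t).
  assert (htau : 0 < tau).
  { assert (ln t < ln t') by (apply ln_increasing; lra). unfold tau; lra. }
  assert (l5 : ln x7 < ln x5) by (apply ln_increasing; lra).
  assert (l5' : ln x7' < ln x5') by (apply ln_increasing; lra).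
  assert (l35 : ln x3 < ln x5) by (apply ln_increasing; lra).
  assert (l35' : ln x3' < ln x5') by (apply ln_increasing; lra).
  assert (lab : ln b < ln a) by (apply ln_increasing; lra).
  assert (lab' : ln b' < ln a') by (apply ln_increasing; lra).
  assert (lbe : ln b < ln e) by (apply ln_increasing; lra).
  assert (lec : ln e < ln c) by (apply ln_increasing; lra).
  assert (lbb : ln b <= ln b') by (apply ln_le_compat; lra).
  (* [fgap] grows at most al - 1 times as fast as its argument, which here grows by at most tau/al:
     x5 does not grow, while t x7^al = 1 + e does. *)
  assert (hf5 : fgap al (ln x5' - ln x7') - fgap al (ln x5 - ln x7) <= tau - tau / al).
  { assert (h := hgap_le al _ _ ha (conj (proj2 (Rlt_0_minus _ _) l5) hu5)).
    unfold hgap in h.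
    assert (hk : al * (ln x5' - ln x7' - (ln x5 - ln x7)) <= tau) by (unfold tau; lra).
    assert (hk2 : ln x5' - ln x7' - (ln x5 - ln x7) <= tau / al).
    { apply Rmult_le_reg_l with al; [lra|].
      replace (al * (tau / al)) with tau by (field; lra). lra. }
    assert (hk3 : (al - 1) * (ln x5' - ln x7' - (ln x5 - ln x7)) <= (al - 1) * (tau / al)).
    { apply Rmult_le_compat_l; lra. }
    replace ((al - 1) * (tau / al)) with (tau - tau / al) in hk3 by (field; lra).
    lra. }
  assert (hL4 := lgap_left_contract (ln c - ln b) (ln c - ln e)
    (ln c' - ln b') (ln c' - ln e') ltac:(lra) ltac:(lra) ltac:(lra)).
  assert (hm2 := fgap_le al (ln a - ln b) (ln a' - ln b') ha ltac:(lra)).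
  assert (hshift : forall x x', al * ln x + ln t <= al * ln x' + ln t' ->
            ln x - tau / al <= ln x').
  { intros x x' h. apply Rmult_le_reg_l with al; [lra|].
    replace (al * (ln x - tau / al)) with (al * ln x - tau) by (field; lra).
    unfold tau; lra. }
  assert (s3 : ln x3 - tau / al <= ln x3') by (apply hshift; lra).
  assert (s5 : ln x5 - tau / al <= ln x5') by (apply hshift; lra).
  (* x3 and x5 fall at most by the factor (t'/t)^(1/al), which costs at most tau - tau/al in the
     chord slope. Of the 2 tau in [window_growth] at least tau + tau/al remains, more than the bound
     in [hf5]. *)
  assert (hc3 : (al - 1) * (ln x3 - tau / al) + fgap al (ln x5 - tau / al - (ln x3 - tau / al))
    <= (al - 1) * ln x3' + fgap al (ln x5' - ln x3')).
  { apply fgap_corner_le; lra. }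
  replace (ln x5 - tau / al - (ln x3 - tau / al)) with (ln x5 - ln x3) in hc3 by ring.
  replace ((al - 1) * (ln x3 - tau / al)) with ((al - 1) * ln x3 - tau + tau / al)
    in hc3 by (field; lra).
  assert (hb2 : (al - 1) * ln b <= (al - 1) * ln b') by (apply Rmult_le_compat_l; lra).
  assert (0 < tau / al) by (apply Rdiv_lt_0_compat; lra).
  unfold tau in *. lra.
Qed.

Lemma rl_orbit_window (al t : R) (q : nat -> R) (k : nat) :
  1 < al -> rl_orbit al t q ->
  window al t (q (4*k+2)%nat) (q (4*k+4)%nat) (q (4*k+6)%nat) (q (4*k+8)%nat)
    (q (4*k+3)%nat) (q (4*k+5)%nat) (q (4*k+7)%nat) /\
  gap q (4*k+2)%nat = ln (q (4*k+2)%nat) - ln (q (4*k+4)%nat) /\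
  gap q (4*k+4)%nat = ln (q (4*k+6)%nat) - ln (q (4*k+4)%nat) /\
  gap q (4*k+5)%nat = ln (q (4*k+5)%nat) - ln (q (4*k+7)%nat) /\
  gap q (4*k+6)%nat = ln (q (4*k+6)%nat) - ln (q (4*k+8)%nat).
Proof.
intros hal hq.
destruct (rl_orbit_order al t q k ltac:(lra) hq) as [_ [_ [o3 o4]]].
destruct (rl_orbit_order al t q (S k) ltac:(lra) hq) as [o5 _].
assert (hpos := fun n => rl_orbit_pos al t q n hq).
destruct hq as [ht [_ [_ [_ hd]]]].
destruct (hd k) as [_ [e3 [e4 e5]]]. destruct (hd (S k)) as [e6 [_ [e8 _]]].
replace (4 * S k)%nat with (4*k+4)%nat in * by lia.
replace (4*k+4+1)%nat with (4*k+5)%nat in * by lia.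
replace (4*k+4+2)%nat with (4*k+6)%nat in * by lia.
replace (4*k+4+3)%nat with (4*k+7)%nat in * by lia.
replace (4*k+4+4)%nat with (4*k+8)%nat in * by lia.
assert (p3 := hpos (4*k+3)%nat ltac:(lia)). assert (p4 := hpos (4*k+4)%nat ltac:(lia)).
split; [|split; [|split; [|split]]].
- repeat split; try assumption; lra.
- apply gap_decreasing; [lia|lra].
- apply gap_increasing; [lia|lra].
- apply gap_decreasing; [lia|lra].
- apply gap_decreasing; [lia|lra].
Qed.

Lemma rl_orbit_compare (al t t' d : R) (q q' : nat -> R) :
  1 < al -> 0 <= d -> t < t' -> rl_orbit al t q -> rl_orbit al t' q' ->
  d < lgap (gap q' 1%nat) - lgap (gap q 1%nat) ->
  d < pcoord q' 0%nat - pcoord q 0%nat ->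
  d < pcoord q' 0%nat - fgap al (gap q' 1%nat) - (pcoord q 0%nat - fgap al (gap q 1%nat)) ->
  forall n : nat, d < pcoord q' n - pcoord q n.
Proof.
intros ha hd htt hq hq' h1 h2 h3.
apply (trajectory_compare al (gap q) (pcoord q) (gap q') (pcoord q') d ha hd);
  try assumption.
- apply rl_orbit_trajectory with t; [lra|assumption].
- apply rl_orbit_trajectory with t'; [lra|assumption].
- intros k.
  destruct (rl_orbit_window al t q k ha hq) as [w [g2 [g4 [g5 g6]]]].
  destruct (rl_orbit_window al t' q' k ha hq') as [w' [g2' [g4' [g5' g6']]]].
  rewrite g2, g4, g5, g6, g2', g4', g5', g6'. intros.
  apply (window_compare al d t _ _ _ _ _ _ _ t' _ _ _ _ _ _ _ ha htt w w'); lra.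
Qed.

(** * The initial coordinates as functions of v = |2| *)

(* [1 - 3_a], since [3_a = 1 - (1 + v) v^al]. *)
Definition drop (al v : R) : R := (1 + v) * Rpower v al.

(** The bound places v to the left of al/(al+1), where v^al (1-v) is maximal. Bernoulli with base
    1/(1-m), together with (1-m)^(-al) < 1 + v < 2, gives m < 1/(al+1); Bernoulli with base v then
    gives 1 - al (1-v) <= v^al < m. *)
Lemma drop_bound (al v : R) : 1 < al -> 0 < v < 1 -> 0 < 1 - drop al v ->
  1 < (1 + v) * Rpower (1 - drop al v) al -> v < al * (1 - v).
Proof.
intros ha hv hs hy.
set (m := drop al v) in *.
assert (hm : al * m < 1 - m).
{ assert (hb := bernoulli_exp al (- ln (1 - m)) ltac:(lra)).
  rewrite exp_Ropp, exp_ln in hb by lra.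
  assert (hinv : exp (al * - ln (1 - m)) * Rpower (1 - m) al = 1).
  { unfold Rpower. rewrite <- exp_plus, <- exp_0. f_equal; ring. }
  assert (0 < Rpower (1 - m) al) by apply exp_pos.
  assert (h1 : al * (/ (1 - m) - 1) < 1) by nra.
  replace (/ (1 - m) - 1) with (m / (1 - m)) in h1 by (field; lra).
  apply Rmult_lt_reg_r with (/ (1 - m)); [now apply Rinv_0_lt_compat|].
  replace ((1 - m) * / (1 - m)) with 1 by (field; lra).
  unfold Rdiv in h1; lra. }
assert (hW := bernoulli_exp al (ln v) ltac:(lra)).
rewrite exp_ln in hW by lra.
change (exp (al * ln v)) with (Rpower v al) in hW.
assert (0 < Rpower v al) by apply exp_pos.
assert (hmW : m = Rpower v al + v * Rpower v al) by (unfold m, drop; ring).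
assert (Rpower v al < m) by nra.
nra.
Qed.

(* [P_0 - fgap al u_1 - p_{1,-1}(2)], where [fgap al u_1] bounds the loss at the first odd index. *)
Definition base (al v : R) : R :=
  ln (1 + v) + al * ln v + (al - 1) * ln (1 - drop al v) + ln (1 - v)
  - ln ((1 + v) * Rpower (1 - drop al v) al - 1).

Lemma base_derive (al v : R) : 1 < al -> 0 < v < 1 -> 0 < 1 - drop al v ->
  1 < (1 + v) * Rpower (1 - drop al v) al ->
  let q := drop al v / (1 - drop al v) in
  let E := / (1 + v) + al / v in
  is_derive (base al) v
    (al / v - 1 / (1 - v) + q * E
     + (al * q * E - / (1 + v)) / ((1 + v) * Rpower (1 - drop al v) al - 1)).
Proof.
intros ha hv hs hy.
unfold base, drop, Rpower, Rminus in *.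
auto_derive.
- repeat split; lra.
- set (W := exp (al * ln v)) in *.
  set (s := 1 + - ((1 + v) * W)) in *.
  set (X := exp (al * ln s)) in *.
  (* Eliminating v^al in favour of s leaves an identity that [field] can check. *)
  assert (hW : W = (1 - s) / (1 + v)) by (unfold s; field; lra).
  clearbody s. rewrite hW.
  field. repeat split; lra.
Qed.

(** Here E is the logarithmic derivative of [drop]. By [drop_bound] the terms before the last
    fraction have a positive sum, so only a negative fraction needs work. *)
Lemma base_derive_pos (al v : R) : 1 < al -> 0 < v < 1 -> 0 < 1 - drop al v ->
  1 < (1 + v) * Rpower (1 - drop al v) al ->
  let q := drop al v / (1 - drop al v) in
  let E := / (1 + v) + al / v in
  0 < al / v - 1 / (1 - v) + q * E
     + (al * q * E - / (1 + v)) / ((1 + v) * Rpower (1 - drop al v) al - 1).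
Proof.
intros ha hv hs hy q E.
assert (hav := drop_bound al v ha hv hs hy).
set (y := (1 + v) * Rpower (1 - drop al v) al - 1).
set (m := drop al v) in *.
assert (hy0 : 0 < y) by (unfold y; lra).
assert (hm0 : 0 < m).
{ unfold m, drop; apply Rmult_lt_0_compat; [lra|apply exp_pos]. }
assert (hqm : m <= q).
{ unfold q. apply Rmult_le_reg_r with (1 - m); [lra|].
  replace (m / (1 - m) * (1 - m)) with m by (field; lra). nra. }
assert (hv1 : 0 < / (1 + v)) by (apply Rinv_0_lt_compat; lra).
assert (hv2 : 0 < / v) by (apply Rinv_0_lt_compat; lra).
assert (hE : al * / v < E) by (unfold E, Rdiv; lra).
assert (hqE : 0 < q * E) by (apply Rmult_lt_0_compat; nra).
assert (h0 : 1 / (1 - v) < al / v).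
{ apply Rmult_lt_reg_r with (v * (1 - v)); [nra|].
  replace (1 / (1 - v) * (v * (1 - v))) with v by (field; lra).
  replace (al / v * (v * (1 - v))) with (al * (1 - v)) by (field; lra). lra. }
destruct (Rle_or_lt (/ (1 + v)) (al * q * E)) as [hX|hX].
- assert (0 <= (al * q * E - / (1 + v)) / y) by (apply Rdiv_le_0_compat; lra).
  lra.
- assert (hmE : m * (al * / v) <= q * E) by (apply Rmult_le_compat; nra).
  (* The numerator is at least -(1-z)/(1+v), and Bernoulli gives y >= v (1-z). Hence the fraction is
     at least -1/((1+v) v). *)
  set (z := (1 + v) * (al * m) * / v).
  assert (hzz : al * z < 1).
  { assert (h : al * (m * (al * / v)) <= al * (q * E)) by (apply Rmult_le_compat_l; lra).
    assert (h' : (1 + v) * (al * (m * (al * / v))) < (1 + v) * / (1 + v))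
      by (apply Rmult_lt_compat_l; lra).
    rewrite Rinv_r in h' by lra. unfold z. lra. }
  assert (hmv : 0 < (1 + v) * m * / v).
  { apply Rmult_lt_0_compat; [|lra]. apply Rmult_lt_0_compat; lra. }
  assert (hzm : z = al * ((1 + v) * m * / v)) by (unfold z; ring).
  assert (hz0 : 0 < z) by (rewrite hzm; apply Rmult_lt_0_compat; lra).
  assert (hyz : v * (1 - z) <= y).
  { assert (hb := bernoulli_exp al (ln (1 - m)) ltac:(lra)).
    rewrite exp_ln in hb by lra.
    change (exp (al * ln (1 - m))) with (Rpower (1 - m) al) in hb.
    replace (v * (1 - z)) with (v - (1 + v) * (al * m)) by (unfold z; field; lra).
    unfold y. nra. }
  assert (hfrac : - (1 / ((1 + v) * v)) <= (al * q * E - / (1 + v)) / y).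
  { apply Rmult_le_reg_r with y; [lra|].
    replace ((al * q * E - / (1 + v)) / y * y) with (al * q * E - / (1 + v))
      by (field; lra).
    assert (h1 : z * / (1 + v) <= al * q * E).
    { replace (z * / (1 + v)) with (m * (al * / v)) by (unfold z; field; lra).
      assert (h : m * (al * / v) <= al * (q * E)) by nra. lra. }
    assert (h2 : 1 / ((1 + v) * v) * (v * (1 - z)) <= 1 / ((1 + v) * v) * y).
    { apply Rmult_le_compat_l; [|lra].
      left; apply Rdiv_lt_0_compat; nra. }
    replace (1 / ((1 + v) * v) * (v * (1 - z))) with (/ (1 + v) - z * / (1 + v)) in h2
      by (field; lra).
    lra. }
  (* Since al z < 1, also (1+v)^2 v^(al-1) < 1. Elementary bounds on the logarithms turn this into
     [hkey], which is what the lower bound on the fraction requires. *)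
  assert (hln : 2 * ln (1 + v) + (al - 1) * ln v < 0).
  { apply exp_lt_inv. rewrite exp_0.
    assert (hw : exp (2 * ln (1 + v) + (al - 1) * ln v) = (1 + v) * m * / v).
    { replace (2 * ln (1 + v) + (al - 1) * ln v)
        with (ln (1 + v) + (ln (1 + v) + (al * ln v + - ln v))) by ring.
      rewrite !exp_plus, exp_Ropp, !exp_ln by lra.
      unfold m, drop, Rpower; ring. }
    rewrite hw. nra. }
  assert (hl1 : v * / (1 + v) <= ln (1 + v)).
  { assert (h := exp_ineq1_le (- ln (1 + v))).
    rewrite exp_Ropp, exp_ln in h by lra.
    replace (v * / (1 + v)) with (1 - / (1 + v)) by (field; lra). lra. }
  assert (hl2 : - ln v <= / v - 1).
  { assert (h := exp_ineq1_le (- ln v)).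
    rewrite exp_Ropp, exp_ln in h by lra. lra. }
  assert (hkey : 2 * (v * / (1 + v)) < (al - 1) * (/ v - 1)) by nra.
  assert (hkey2 : 0 < (al - 1) / v + 1 / (1 + v) - 1 / (1 - v)).
  { replace ((al - 1) / v + 1 / (1 + v) - 1 / (1 - v))
      with (((al - 1) * (/ v - 1) - 2 * (v * / (1 + v))) / (1 - v)) by (field; lra).
    apply Rdiv_lt_0_compat; lra. }
  replace ((al - 1) / v + 1 / (1 + v) - 1 / (1 - v))
    with (al / v - 1 / (1 - v) - 1 / ((1 + v) * v)) in hkey2 by (field; lra).
  lra.
Qed.

Lemma base_increasing (al v v' : R) : 1 < al -> 0 < v -> v < v' -> v' < 1 ->
  (forall w, v <= w <= v' ->
     0 < 1 - drop al w /\ 1 < (1 + w) * Rpower (1 - drop al w) al) ->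
  base al v < base al v'.
Proof.
intros ha h0 h1 h2 hw.
set (D := fun w => al / w - 1 / (1 - w) + drop al w / (1 - drop al w) * (/ (1 + w) + al / w)
  + (al * (drop al w / (1 - drop al w)) * (/ (1 + w) + al / w) - / (1 + w))
    / ((1 + w) * Rpower (1 - drop al w) al - 1)).
assert (hd : forall w, v <= w <= v' -> is_derive (base al) w (D w)).
{ intros w hvw. destruct (hw w hvw). apply base_derive; lra. }
destruct (MVT_gen (base al) v v' D) as [c [hc he]].
- intros x hx; apply hd; rewrite Rmin_left, Rmax_right in hx; lra.
- intros x hx; apply derivable_continuous_pt; exists (D x).
  apply is_derive_Reals, hd; rewrite Rmin_left, Rmax_right in hx; lra.
- rewrite Rmin_left, Rmax_right in hc by lra.
  destruct (hw c hc).
  assert (hp : 0 < D c) by (apply base_derive_pos; lra).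
  nra.
Qed.

Lemma drop_le (al v v' : R) : 1 < al -> 0 < v <= v' -> drop al v <= drop al v'.
Proof.
intros ha hv. unfold drop.
assert (Rpower v al <= Rpower v' al) by (apply Rle_Rpower_l; lra).
apply Rmult_le_compat; try lra. left; apply exp_pos.
Qed.

(** v^al (1-v) increases up to al/(al+1); tangent bounds on both logarithms replace a derivative. *)
Lemma power_hat_lt (al v v' : R) : 1 < al -> 0 < v -> v < v' -> v' < al * (1 - v') ->
  al * ln v + ln (1 - v) < al * ln v' + ln (1 - v').
Proof.
intros ha h0 h1 h2.
assert (hv' : v' < 1) by nra.
assert (hl1 : 1 - v / v' <= ln v' - ln v).
{ assert (h := exp_ineq1_le (ln v - ln v')). rewrite exp_ln_diff in h; lra. }
assert (hl2 : ln (1 - v) - ln (1 - v') <= (v' - v) / (1 - v')).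
{ assert (h := exp_ineq1_le (ln (1 - v) - ln (1 - v'))). rewrite exp_ln_diff in h by lra.
  replace ((v' - v) / (1 - v')) with ((1 - v) / (1 - v') - 1) by (field; lra). lra. }
assert (hk : (v' - v) / (1 - v') < al * (1 - v / v')).
{ replace (al * (1 - v / v')) with ((v' - v) * (al / v')) by (field; lra).
  apply Rmult_lt_compat_l; [lra|].
  apply Rmult_lt_reg_r with (v' * (1 - v')); [nra|].
  replace (/ (1 - v') * (v' * (1 - v'))) with v' by (field; lra).
  replace (al / v' * (v' * (1 - v'))) with (al * (1 - v')) by (field; lra). lra. }
nra.
Qed.

(* [p_{1,-1}(-v)]. *)
Definition mirror_coord (v : R) : R := ln ((1 + v) / (1 - v)).

Lemma mirror_coord_lt (v v' : R) : 0 < v -> v < v' -> v' < 1 -> mirror_coord v < mirror_coord v'.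
Proof.
intros h0 h1 h2. unfold mirror_coord. apply ln_increasing; [apply Rdiv_lt_0_compat; lra|].
apply Rmult_lt_reg_r with ((1 - v) * (1 - v')); [nra|].
replace ((1 + v) / (1 - v) * ((1 - v) * (1 - v'))) with ((1 + v) * (1 - v')) by (field; lra).
replace ((1 + v') / (1 - v') * ((1 - v) * (1 - v'))) with ((1 + v') * (1 - v)) by (field; lra).
nra.
Qed.

Lemma rl_orbit_start (al v : R) (q : nat -> R) : 1 < al -> 0 < v < 1 ->
  rl_orbit al (1 + v) q ->
  0 < 1 - drop al v /\ 1 < (1 + v) * Rpower (1 - drop al v) al /\
  gap q 1%nat = - ln (1 - drop al v) /\
  lgap (gap q 1%nat) = ln (drop al v) - ln (1 - drop al v) /\
  pcoord q 0%nat - fgap al (gap q 1%nat) = base al v + mirror_coord v.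
Proof.
intros ha hv hq.
destruct (rl_orbit_order al _ q 0 ltac:(lra) hq) as [o1 [o2 _]].
assert (p3 := rl_orbit_pos al _ q 3 hq ltac:(lia)).
destruct hq as [_ [h0 [h1 [_ hd]]]].
destruct (hd 0%nat) as [e2 [e3 [e4 _]]]. simpl in *.
assert (hone : Rpower 1 al = 1).
{ unfold Rpower; rewrite ln_1, Rmult_0_r; apply exp_0. }
rewrite h1, hone in e2.
assert (e2' : q 2%nat = v) by lra.
rewrite e2' in e3.
assert (e3' : q 3%nat = 1 - drop al v) by (rewrite e3; unfold drop; ring).
rewrite e3' in e4, p3.
assert (hm0 : 0 < drop al v).
{ unfold drop; apply Rmult_lt_0_compat; [lra|apply exp_pos]. }
assert (hg : gap q 1%nat = ln 1 - ln (1 - drop al v)).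
{ rewrite (gap_decreasing q 1 3) by (lia || lra). rewrite h1, e3'; reflexivity. }
assert (hpw : Rpower (1 - drop al v) al < 1).
{ rewrite <- hone at 2. apply Rlt_Rpower_l; lra. }
assert (hpw0 : 0 < Rpower (1 - drop al v) al) by apply exp_pos.
split; [lra|]. split; [lra|]. split; [rewrite hg, ln_1; ring|]. split.
- rewrite hg, lgap_ln_diff by lra. f_equal; f_equal; ring.
- rewrite hg, fgap_ln_diff, hone by lra.
  unfold pcoord, base, mirror_coord; simpl. rewrite h0, e2', e4.
  set (X := Rpower (1 - drop al v) al) in *.
  replace ((-1 + (1 + v) * X - v) / (0 - (-1 + (1 + v) * X)))
    with ((1 + v) * (1 - X) / ((1 + v) * X - 1)) by (field; lra).
  rewrite !ln_div, ln_mult by nra.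
  replace (1 - (1 - drop al v)) with (drop al v) by ring.
  assert (hX : ln X = al * ln (1 - drop al v)) by apply ln_exp.
  assert (hm : ln (drop al v) = ln (1 + v) + al * ln v).
  { unfold drop. rewrite ln_mult by (try apply exp_pos; lra).
    unfold Rpower; rewrite ln_exp; reflexivity. }
  rewrite hX, hm. ring.
Qed.

Lemma rl_orbit_pcoord_lt (al v v' : R) (q q' : nat -> R) :
  1 < al -> 0 < v -> v < v' -> v' < 1 ->
  rl_orbit al (1 + v) q -> rl_orbit al (1 + v') q' ->
  (forall w, v <= w <= v' ->
     0 < 1 - drop al w /\ 1 < (1 + w) * Rpower (1 - drop al w) al) ->
  forall n : nat, mirror_coord v' - mirror_coord v < pcoord q' n - pcoord q n.
Proof.
intros ha h0 h1 h2 hq hq' hw.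
destruct (rl_orbit_start al v q ha ltac:(lra) hq) as [s1 [s2 [g1 [l1 b1]]]].
destruct (rl_orbit_start al v' q' ha ltac:(lra) hq') as [s1' [s2' [g1' [l1' b1']]]].
assert (hb := base_increasing al v v' ha h0 h1 h2 hw).
assert (hdl := drop_le al v v' ha ltac:(lra)).
assert (hm0 : 0 < drop al v).
{ unfold drop; apply Rmult_lt_0_compat; [lra|apply exp_pos]. }
assert (hgap0 : 0 < gap q 1%nat <= gap q' 1%nat).
{ rewrite g1, g1'. split.
  - assert (ln (1 - drop al v) < ln 1) by (apply ln_increasing; lra). rewrite ln_1 in *; lra.
  - assert (ln (1 - drop al v') <= ln (1 - drop al v)) by (apply ln_le_compat; lra). lra. }
assert (hf := fgap_le al _ _ ha hgap0).
assert (hdelta := mirror_coord_lt v v' h0 h1 h2).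
apply (rl_orbit_compare al (1 + v) (1 + v') (mirror_coord v' - mirror_coord v) q q');
  try assumption; try lra.
(* ln ([drop al v]) - [mirror_coord v] is al ln v + ln (1-v), so [power_hat_lt] gives the growth,
   helped by the decrease of 1 - [drop al v]. *)
rewrite l1, l1'.
assert (hh := power_hat_lt al v v' ha h0 h1 (drop_bound al v' ha ltac:(lra) s1' s2')).
assert (hlm : forall w, 0 < w -> ln (drop al w) = ln (1 + w) + al * ln w).
{ intros w hw0. unfold drop. rewrite ln_mult by (try apply exp_pos; lra).
  unfold Rpower; rewrite ln_exp; reflexivity. }
rewrite !hlm by lra.
assert (ln (1 - drop al v') <= ln (1 - drop al v)) by (apply ln_le_compat; lra).
unfold mirror_coord. rewrite !ln_div by lra. lra.
Qed.

(** * From Poincaré coordinates to gap ratios *)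

Lemma rl_orbit_between (al t : R) (q : nat -> R) (n : nat) :
  0 < al -> rl_orbit al t q ->
  q n < q (n+4)%nat < q (n+2)%nat \/ q (n+2)%nat < q (n+4)%nat < q n.
Proof.
intros ha hq.
destruct (rl_orbit_order al t q (n / 4) ha hq) as [o1 [o2 [o3 o4]]].
assert (hm := Nat.mod_upper_bound n 4 ltac:(lia)).
assert (hd := Nat.div_mod n 4 ltac:(lia)).
set (k := (n / 4)%nat) in *.
destruct (n mod 4)%nat as [|[|[|[|m]]]]; [| | | |lia].
- replace n with (4*k)%nat by lia. left; assumption.
- replace n with (4*k+1)%nat by lia. rewrite <- !Nat.add_assoc. right; assumption.
- replace n with (4*k+2)%nat by lia. rewrite <- !Nat.add_assoc. right; assumption.
- replace n with (4*k+3)%nat by lia. rewrite <- !Nat.add_assoc. left; assumption.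
Qed.

Lemma rl_orbit_ratio (al t : R) (q : nat -> R) (n : nat) :
  0 < al -> rl_orbit al t q ->
  Rabs (q (n+4)%nat - q (n+2)%nat) / Rabs (q (n+2)%nat - q n) = / (1 + exp (- pcoord q n)).
Proof.
intros ha hq. unfold pcoord.
destruct (rl_orbit_between al t q n ha hq) as [h|h].
- rewrite Rabs_left, Rabs_right by lra.
  replace ((q (n+4)%nat - q (n+2)%nat) / (q n - q (n+4)%nat))
    with ((q (n+2)%nat - q (n+4)%nat) / (q (n+4)%nat - q n)) by (field; lra).
  rewrite exp_Ropp, exp_ln by (apply Rdiv_lt_0_compat; lra).
  field; lra.
- rewrite Rabs_right, Rabs_left by lra.
  rewrite exp_Ropp, exp_ln by (apply Rdiv_lt_0_compat; lra).
  field; lra.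
Qed.

Lemma rl_orbit_ratio_lt (al t t' : R) (q q' : nat -> R) (n : nat) :
  0 < al -> rl_orbit al t q -> rl_orbit al t' q' -> pcoord q n < pcoord q' n ->
  Rabs (q (n+4)%nat - q (n+2)%nat) / Rabs (q (n+2)%nat - q n)
  < Rabs (q' (n+4)%nat - q' (n+2)%nat) / Rabs (q' (n+2)%nat - q' n).
Proof.
intros ha hq hq' h.
rewrite (rl_orbit_ratio al t q), (rl_orbit_ratio al t' q') by assumption.
assert (exp (- pcoord q' n) < exp (- pcoord q n)) by (apply exp_increasing; lra).
pose proof (exp_pos (- pcoord q' n)).
apply Rinv_lt_contravar; [apply Rmult_lt_0_compat|]; lra.
Qed.

(** * The orbits of the critical point *)

Lemma abspow_pos_eq (al x : R) : 0 < x -> abspow al x = Rpower x al.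
Proof.
intros h. unfold abspow. destruct (Req_EM_T x 0); [lra|].
rewrite Rabs_right by lra. reflexivity.
Qed.

Lemma abspow_Rabs (al x : R) : abspow al (Rabs x) = abspow al x.
Proof.
unfold abspow. destruct (Req_EM_T (Rabs x) 0) as [h|h]; destruct (Req_EM_T x 0) as [h'|h'].
- reflexivity.
- exfalso; apply (Rabs_no_R0 x h' h).
- exfalso; apply h; rewrite h'; apply Rabs_R0.
- rewrite Rabs_Rabsolu; reflexivity.
Qed.

Lemma abspow_scale (al a y : R) : 0 < a -> abspow al (a * y) = Rpower a al * abspow al y.
Proof.
intros h. unfold abspow.
destruct (Req_EM_T y 0) as [hy|hy]; destruct (Req_EM_T (a * y) 0) as [hay|hay].
- ring.
- exfalso; apply hay; rewrite hy; ring.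
- exfalso; apply Rmult_integral in hay; destruct hay; lra.
- assert (0 < Rabs y) by now apply Rabs_pos_lt.
  rewrite Rabs_mult, (Rabs_right a), Rpower_mult_distr by lra. reflexivity.
Qed.

Lemma fmap_0 (al a : R) : fmap al a 0 = a.
Proof. unfold fmap, abspow. destruct (Req_EM_T 0 0); [ring|lra]. Qed.

Lemma orb_0 (al a : R) : orb al a 0 = 0.
Proof. unfold orb; simpl; unfold Rdiv; ring. Qed.

Lemma orb_S (al a : R) (n : nat) : 0 < a ->
  orb al a (S n) = 1 - Rpower a (al - 1) * abspow al (orb al a n).
Proof.
intros ha. unfold orb. rewrite fmap_0, Nat.iter_succ.
set (x := Nat.iter n (fmap al a) 0).
replace x with (a * (x / a)) at 1 by (field; lra).
unfold fmap at 1. rewrite abspow_scale by lra.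
assert (e : Rpower a al = Rpower a (al - 1) * a).
{ rewrite <- (Rpower_1 a) at 3 by lra. rewrite <- Rpower_plus. f_equal; ring. }
rewrite e. field; lra.
Qed.

Lemma orb_1 (al a : R) : 0 < a -> orb al a 1 = 1.
Proof.
intros ha. rewrite orb_S, orb_0 by lra. unfold abspow.
destruct (Req_EM_T 0 0); [ring|lra].
Qed.

Lemma orb_2 (al a : R) : 0 < a -> orb al a 2 = 1 - Rpower a (al - 1).
Proof.
intros ha. rewrite orb_S, orb_1, abspow_pos_eq by lra.
unfold Rpower at 2. rewrite ln_1, Rmult_0_r, exp_0. ring.
Qed.

Definition absorb (al a : R) (n : nat) : R := Rabs (orb al a n).

Lemma orb_sign (al a : R) (k : nat) : kneading_RL al a ->
  orb al a (2*k) = - absorb al a (2*k) /\ orb al a (2*k+1) = absorb al a (2*k+1).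
Proof.
intros hk. unfold absorb. split.
- destruct k as [|k].
  + simpl; rewrite orb_0, Rabs_R0; ring.
  + destruct (hk k) as [_ h]. replace (2 * S k)%nat with (2*k+2)%nat by lia.
    rewrite Rabs_left by lra; ring.
- destruct (hk k) as [h _]. rewrite Rabs_right by lra; reflexivity.
Qed.

Lemma absorb_rl_orbit (al a : R) : admissible al a -> kneading_RL al a ->
  rl_orbit al (1 + - orb al a 2) (absorb al a).
Proof.
intros [ha [_ h2]] hk.
assert (et : 1 + - orb al a 2 = Rpower a (al - 1)) by (rewrite orb_2 by lra; ring).
rewrite et.
assert (hpos : forall n, 0 < absorb al a (S n)).
{ intros n. apply Rabs_pos_lt.
  destruct (Nat.Even_or_Odd n) as [[m ->]|[m ->]]; destruct (hk m) as [k1 k2].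
  - replace (S (2*m)) with (2*m+1)%nat by lia. lra.
  - replace (S (2*m+1)) with (2*m+2)%nat by lia. lra. }
assert (hS : forall n, orb al a (S (S n)) = 1 - Rpower a (al - 1) * Rpower (absorb al a (S n)) al).
{ intros n. rewrite orb_S, <- (abspow_pos_eq al (absorb al a (S n))) by (try apply hpos; lra).
  unfold absorb; rewrite abspow_Rabs; reflexivity. }
split; [apply exp_pos|]. split; [unfold absorb; rewrite orb_0; apply Rabs_R0|].
split; [unfold absorb; rewrite orb_1 by lra; apply Rabs_R1|].
split; [exact hpos|].
intros k.
assert (s1 := orb_sign al a (2*k+1) hk). assert (s2 := orb_sign al a (2*k+2) hk).
assert (h2' := hS (4*k)%nat). assert (h3' := hS (4*k+1)%nat).
assert (h4' := hS (4*k+2)%nat). assert (h5' := hS (4*k+3)%nat).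
replace (2 * (2*k+1))%nat with (4*k+2)%nat in s1 by lia.
replace (2 * (2*k+2))%nat with (4*k+4)%nat in s2 by lia.
replace (4*k+2+1)%nat with (4*k+3)%nat in s1 by lia.
replace (4*k+4+1)%nat with (4*k+5)%nat in s2 by lia.
replace (S (S (4*k))) with (4*k+2)%nat in h2' by lia.
replace (S (4*k)) with (4*k+1)%nat in h2' by lia.
replace (S (S (4*k+1))) with (4*k+3)%nat in h3' by lia.
replace (S (4*k+1)) with (4*k+2)%nat in h3' by lia.
replace (S (S (4*k+2))) with (4*k+4)%nat in h4' by lia.
replace (S (4*k+2)) with (4*k+3)%nat in h4' by lia.
replace (S (S (4*k+3))) with (4*k+5)%nat in h5' by lia.
replace (S (4*k+3)) with (4*k+4)%nat in h5' by lia.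
repeat split; lra.
Qed.

Lemma poincare_orb (al a : R) (n : nat) : kneading_RL al a ->
  poincare (orb al a (n+2)) (orb al a n) (orb al a (n+4)) = pcoord (absorb al a) n.
Proof.
intros hk. unfold poincare, pcoord.
assert (hs := fun k => orb_sign al a k hk).
destruct (Nat.Even_or_Odd n) as [[m ->]|[m ->]].
- destruct (hs m) as [e0 _]. destruct (hs (m+1)%nat) as [e2 _]. destruct (hs (m+2)%nat) as [e4 _].
  replace (2 * (m+1))%nat with (2*m+2)%nat in e2 by lia.
  replace (2 * (m+2))%nat with (2*m+4)%nat in e4 by lia.
  rewrite e0, e2, e4. f_equal.
  replace (- absorb al a (2*m) - - absorb al a (2*m+4))
    with (- (absorb al a (2*m) - absorb al a (2*m+4))) by ring.
  replace (- absorb al a (2*m+4) - - absorb al a (2*m+2))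
    with (- (absorb al a (2*m+4) - absorb al a (2*m+2))) by ring.
  unfold Rdiv. rewrite Rinv_opp. ring.
- destruct (hs m) as [_ e0]. destruct (hs (m+1)%nat) as [_ e2]. destruct (hs (m+2)%nat) as [_ e4].
  replace (2 * (m+1) + 1)%nat with (2*m+1+2)%nat in e2 by lia.
  replace (2 * (m+2) + 1)%nat with (2*m+1+4)%nat in e4 by lia.
  rewrite e0, e2, e4. reflexivity.
Qed.

Lemma Rabs_orb_sub (al a : R) (n : nat) : kneading_RL al a ->
  Rabs (orb al a (n+2) - orb al a n) = Rabs (absorb al a (n+2) - absorb al a n).
Proof.
intros hk.
assert (hs := fun k => orb_sign al a k hk).
destruct (Nat.Even_or_Odd n) as [[m ->]|[m ->]].
- destruct (hs m) as [e0 _]. destruct (hs (m+1)%nat) as [e2 _].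
  replace (2 * (m+1))%nat with (2*m+2)%nat in e2 by lia.
  rewrite e0, e2.
  rewrite <- Rabs_Ropp. f_equal; ring.
- destruct (hs m) as [_ e0]. destruct (hs (m+1)%nat) as [_ e2].
  replace (2 * (m+1) + 1)%nat with (2*m+1+2)%nat in e2 by lia.
  rewrite e0, e2. reflexivity.
Qed.

Lemma abar_lt_iff (al a a' : R) : admissible al a -> admissible al a' ->
  (abar al a < abar al a' <-> - orb al a 2 < - orb al a' 2).
Proof.
intros [_ h] [_ h']. unfold abar, poincare. rewrite !Rabs_left by lra.
set (v := - orb al a 2) in *. set (v' := - orb al a' 2) in *.
assert (hv : 0 < v < 1) by (unfold v; lra). assert (hv' : 0 < v' < 1) by (unfold v'; lra).
assert (key : forall x y, 0 < x < 1 -> 0 < y < 1 -> x <= y ->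
          ln ((x - 0) / (1 - x)) <= ln ((y - 0) / (1 - y))).
{ intros x y hx hy hxy. apply ln_le_compat; [apply Rdiv_lt_0_compat; lra|].
  apply Rmult_le_reg_r with ((1 - x) * (1 - y)); [nra|].
  replace ((x - 0) / (1 - x) * ((1 - x) * (1 - y))) with (x * (1 - y)) by (field; lra).
  replace ((y - 0) / (1 - y) * ((1 - x) * (1 - y))) with (y * (1 - x)) by (field; lra).
  nra. }
split; intros hlt.
- destruct (Rlt_or_le v v') as [hc|hc]; [assumption|].
  assert (hk := key v' v hv' hv hc). lra.
- apply ln_increasing; [apply Rdiv_lt_0_compat; lra|].
  apply Rmult_lt_reg_r with ((1 - v) * (1 - v')); [nra|].
  replace ((v - 0) / (1 - v) * ((1 - v) * (1 - v'))) with (v * (1 - v')) by (field; lra).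
  replace ((v' - 0) / (1 - v') * ((1 - v) * (1 - v'))) with (v' * (1 - v)) by (field; lra).
  nra.
Qed.

(** Solves a^(al-1) = 1 + w, so that a whole interval of values |2_a| can be tested against the
    half-line hypothesis. *)
Lemma admissible_of_abs_orb_2 (al w : R) : 1 < al -> 0 < w < 1 ->
  exists a : R, admissible al a /\ - orb al a 2 = w.
Proof.
intros ha hw.
set (a := Rpower (1 + w) (/ (al - 1))).
assert (ha1 : 1 < a).
{ unfold a, Rpower. apply exp_gt_1. apply Rmult_lt_0_compat.
  - apply Rinv_0_lt_compat; lra.
  - rewrite <- ln_1; apply ln_increasing; lra. }
assert (e : orb al a 2 = - w).
{ rewrite orb_2 by lra. unfold a. rewrite Rpower_mult.
  replace (/ (al - 1) * (al - 1)) with 1 by (field; lra).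
  rewrite Rpower_1 by lra. ring. }
exists a. split; [split; [assumption|]|]; rewrite e; lra.
Qed.

Lemma pcoord_absorb_lt (alpha : R) (halpha : 1 < alpha) (abar1 : R)
  (habar1 : forall a : R, admissible alpha a ->
              (kneading_RL alpha a <-> abar alpha a < abar1))
  (a a' : R) : admissible alpha a -> admissible alpha a' ->
  abar alpha a < abar alpha a' -> abar alpha a' < abar1 ->
  forall n : nat,
    mirror_coord (- orb alpha a' 2) - mirror_coord (- orb alpha a 2)
    < pcoord (absorb alpha a') n - pcoord (absorb alpha a) n.
Proof.
intros hA hA' hlt hb.
assert (hk' : kneading_RL alpha a') by (apply habar1; assumption).
assert (hk : kneading_RL alpha a) by (apply habar1; [assumption|lra]).
assert (hv := proj1 (abar_lt_iff alpha a a' hA hA') hlt).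
assert (h2 := proj2 hA). assert (h2' := proj2 hA').
apply (rl_orbit_pcoord_lt alpha); try lra.
- apply absorb_rl_orbit; assumption.
- apply absorb_rl_orbit; assumption.
(* Each intermediate w is |2_b| for a parameter b with [abar] below [abar1]. Its orbit is again
   RLRL, and positivity of its q_3 and q_4 gives the two domain conditions for [base] at w. *)
- intros w hw.
  destruct (admissible_of_abs_orb_2 alpha w halpha ltac:(lra)) as [b [hB hbw]].
  assert (hbk : kneading_RL alpha b).
  { apply habar1; [assumption|].
    destruct (Rlt_or_le (abar alpha b) abar1) as [hc|hc]; [assumption|].
    assert (hc' := proj1 (abar_lt_iff alpha a' b hA' hB) ltac:(lra)). lra. }
  assert (ho := absorb_rl_orbit alpha b hB hbk). rewrite hbw in ho.
  destruct (rl_orbit_start alpha w _ halpha ltac:(lra) ho) as [s1 [s2 _]].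
  split; assumption.
Qed.

Theorem theorem5p1 (alpha : R) (halpha : 1 < alpha) (abar1 : R)
  (habar1 : forall a : R, admissible alpha a ->
              (kneading_RL alpha a <-> abar alpha a < abar1)) :
  (forall a a' : R, admissible alpha a -> admissible alpha a' ->
     abar alpha a < abar alpha a' -> abar alpha a' < abar1 ->
     forall n : nat,
       r_e alpha a n < r_e alpha a' n /\ r_o alpha a n < r_o alpha a' n) /\
  (forall a a' : R, admissible alpha a -> admissible alpha a' ->
     abar alpha a < abar alpha a' -> abar alpha a' < abar1 ->
     forall n : nat,
       poincare (orb alpha a' (n+2)) (orb alpha a' n) (orb alpha a' (n+4))
       - poincare (orb alpha a (n+2)) (orb alpha a n) (orb alpha a (n+4))
       > poincare 1 (-1) (orb alpha a' 2) - poincare 1 (-1) (orb alpha a 2)).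
Proof.
split; intros a a' hA hA' hlt hb n;
  assert (hp := pcoord_absorb_lt alpha halpha abar1 habar1 a a' hA hA' hlt hb);
  assert (hk' : kneading_RL alpha a') by (apply habar1; assumption);
  assert (hk : kneading_RL alpha a) by (apply habar1; [assumption|lra]);
  assert (hv := proj1 (abar_lt_iff alpha a a' hA hA') hlt);
  assert (h2 := proj2 hA); assert (h2' := proj2 hA').
- assert (hd := mirror_coord_lt (- orb alpha a 2) (- orb alpha a' 2) ltac:(lra) hv ltac:(lra)).
  assert (hr := fun m => rl_orbit_ratio_lt alpha _ _ (absorb alpha a) (absorb alpha a') m
    ltac:(lra) (absorb_rl_orbit alpha a hA hk) (absorb_rl_orbit alpha a' hA' hk')
    ltac:(specialize (hp m); lra)).
  assert (hdiff : forall b m, kneading_RL alpha b ->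
    Rabs (orb alpha b (m+4) - orb alpha b (m+2)) / Rabs (orb alpha b (m+2) - orb alpha b m)
    = Rabs (absorb alpha b (m+4) - absorb alpha b (m+2))
      / Rabs (absorb alpha b (m+2) - absorb alpha b m)).
  { intros b m hkb. replace (m+4)%nat with (m+2+2)%nat by lia.
    rewrite !Rabs_orb_sub by assumption. reflexivity. }
  assert (he := hr (2*n)%nat). assert (ho := hr (2*n+1)%nat).
  rewrite <- !hdiff in he, ho by assumption.
  replace (2*n+1+4)%nat with (2*n+5)%nat in ho by lia.
  replace (2*n+1+2)%nat with (2*n+3)%nat in ho by lia.
  split; assumption.
- rewrite !poincare_orb by assumption.
  assert (hdelta : forall x, -1 < x < 0 -> poincare 1 (-1) x = mirror_coord (- x)).
  { intros x hx. unfold poincare, mirror_coord. f_equal. field; lra. }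
  rewrite !hdelta by assumption.
  apply hp.
Qed.
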